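(* Assume that $(\boldsymbol{w},\{\Gamma(t)\}_{0\le t\le T})$ is a (strong) solution of the three-phase Mullins--Sekerka problem $$\begin{cases}\Delta\boldsymbol{w}=\boldsymbol{0} & \text{in } \Omega\setminus\Gamma(t),\\ \boldsymbol{w}\cdot[\boldsymbol{\chi}]=\sigma\varkappa & \text{on }\Gamma(t),\\ [\nabla\boldsymbol{w}]\,\vec\nu=-V[\boldsymbol{\chi}] & \text{on }\Gamma(t),\\ \partial_{\vec\nu_\Omega}\boldsymbol{w}=\boldsymbol{0} & \text{on }\partial\Omega,\\ \sum_{i=1}^3\sigma_i\vec\mu_i=\vec 0 & \text{on }\partial\Gamma_1(t)\cap\partial\Gamma_2(t)\cap\partial\Gamma_3(t),\\ \Gamma(0)=\Gamma^0,\end{cases}$$ for times $t\in[0,T]$. Then $$\frac{\mathrm d}{\mathrm dt}|\Gamma(t)|_\sigma+\int_\Omega|\nabla\boldsymbol{w}|^2\,\mathrm d\mathcal L^2=0,$$ where $|\Gamma(t)|_\sigma=\sum_{i=1}^3\sigma_i|\Gamma_i(t)|=\sum_{i=1}^3\sigma_i\int_{\Gamma_i(t)}1\,\mathrm d\mathcal H^1$ is the weighted length.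
   Context: Setting. $\Omega\subset\mathbb R^2$ is a bounded domain with outer unit normal $\vec\nu_\Omega$ on $\partial\Omega$. For each $t\in[0,T]$, $\Gamma(t)=\Gamma_1(t)\cup\Gamma_2(t)\cup\Gamma_3(t)\subset\Omega$ is a network of three evolving smooth open (i.e. non-closed) curves that share the same two endpoints, the triple junctions $\mathcal T_1(t),\mathcal T_2(t)$, and do not otherwise intersect. The network partitions $\Omega$ into three phases $\Omega_1(t),\Omega_2(t),\Omega_3(t)$, bounded by $\Gamma_2(t)\cup\Gamma_3(t)$, by $\Gamma_1(t)\cup\Gamma_3(t)$, and by $\Gamma_1(t)\cup\Gamma_2(t)\cup\partial\Omega$, respectively. Notation. $\vec\nu=\vec\nu_i$ on $\Gamma_i(t)$ is a unit normal, oriented so that $\vec\nu_1$ points from $\Omega_2$ into $\Omega_3$, $\vec\nu_2$ from $\Omega_3$ into $\Omega_1$, and $\vec\nu_3$ from $\Omega_1$ into $\Omega_2$. $V$ is the velocity of $\Gamma(t)$ in the direction $\vec\nu$. $\varkappa$ is the curvature of $\Gamma(t)$ (on the interiors of the $\Gamma_i(t)$), with sign convention $\Delta_s\vec{\mathrm{Id}}=\varkappa\vec\nu$ (so that unit circles with inner... respectively outer normal conventions follow this identity; with outward normal a unit circle has $\varkappa=-1$), where $\Delta_s$ is the second arclength derivative. $\sigma=\sigma_i$ on $\Gamma_i(t)$, where $\sigma_i$ are constant surface tension coefficients with $\sigma_1\le\sigma_2+\sigma_3$, $\sigma_2\le\sigma_1+\sigma_3$, $\sigma_3\le\sigma_1+\sigma_2$.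 $\vec\mu_i$ is the outer unit co-normal of $\Gamma_i(t)$ at its endpoints (unit tangent pointing out of the curve). $\boldsymbol\chi=(\chi_1,\chi_2,\chi_3)^T$ with $\chi_j$ the characteristic function of $\Omega_j(t)$. The jump is $[q](\vec x)=\lim_{\varepsilon\searrow0}\{q(\vec x+\varepsilon\vec\nu)-q(\vec x-\varepsilon\vec\nu)\}$ for $\vec x\in\Gamma(t)$. $\boldsymbol w=(w_1,w_2,w_3)^T$ takes values in $T\Sigma=\{\boldsymbol u\in\mathbb R^3\mid\sum_{j=1}^3u_j=0\}$; $\nabla\boldsymbol w$ is the matrix with rows $\nabla w_j^T$, and $|\nabla\boldsymbol w|^2=\sum_{j=1}^3|\nabla w_j|^2$. A strong solution is a solution for which $\boldsymbol w(t,\cdot)$ is continuous across $\Gamma(t)$ and which is sufficiently regular (in space up to $\Gamma(t)$ from each side and up to $\partial\Omega$, and in time for the curves) that the equations hold pointwise and integration by parts on each phase and the first variation of length formula are valid. $\mathcal L^2$ and $\mathcal H^1$ denote Lebesgue measure and one-dimensional Hausdorff measure. *)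

(* Defs.v *)
From HB Require Import structures.
From mathcomp Require Import all_boot all_order all_algebra.
From mathcomp Require Import all_classical all_reals all_analysis.

Set Implicit Arguments.
Unset Strict Implicit.
Unset Printing Implicit Defensive.
Import Order.TTheory GRing.Theory Num.Theory.
Import numFieldNormedType.Exports.
Local Open Scope classical_set_scope.
Local Open Scope ring_scope.

(* The plane is [R * R]: its topology and its Borel sets are the product ones.
   The library norm on [R * R] is the sup norm, so that the Euclidean
   structure is introduced by hand. *)

Section plane.
Variable R : realType.
Implicit Types (u v x : R * R) (D : set (R * R)).

Definition dot u v : R := u.1 * v.1 + u.2 * v.2.
Definition enorm u : R := Num.sqrt (dot u u).

Definition e1 : R * R := (1, 0).
Definition e2 : R * R := (0, 1).

Definition frontier D : set (R * R) := closure D `\` interior D.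

Definition C1_on (W : normedModType R) D (f : R * R -> W) : Prop :=
  forall x, D x -> [/\ derivable f x e1, derivable f x e2,
    {for x, continuous ('D_e1 f)} & {for x, continuous ('D_e2 f)}].

Definition C2_on (W : normedModType R) D (f : R * R -> W) : Prop :=
  [/\ C1_on D f, C1_on D ('D_e1 f) & C1_on D ('D_e2 f)].

Definition grad (f : R * R -> R) x : R * R := ('D_e1 f x, 'D_e2 f x).

Definition laplacian (f : R * R -> R) x : R :=
  'D_e1 ('D_e1 f) x + 'D_e2 ('D_e2 f) x.

Definition divergence (F : R * R -> R * R) x : R :=
  'D_e1 (fst \o F) x + 'D_e2 (snd \o F) x.

(* The value at x of q seen from inside D; x is typically on the frontier. *)
Definition trace (W : normedModType R) D (q : R * R -> W) x : W :=
  lim (q y @[y --> within D (nbhs x)]).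

Definition has_trace (W : normedModType R) D (q : R * R -> W) x : Prop :=
  cvg (q y @[y --> within D (nbhs x)]).

Definition jump (W : normedModType R) (q : R * R -> W) (n x : R * R) : W :=
  lim (q (x + e *: n) - q (x - e *: n) @[e --> 0^'+]).

(* Derivative of f at t relative to the set I: one-sided at an endpoint of an
   interval I. *)
Definition is_derive_within (I : set R) (f : R -> R) (t l : R) : Prop :=
  (f s - f t) / (s - t) @[s --> within (I `\ t) (nbhs t)] --> l.

End plane.

Arguments e1 {R}.
Arguments e2 {R}.

Section hausdorff.
Variable R : realType.
Local Open Scope ereal_scope.
Implicit Types A : set (R * R).

(* The element 0 makes the diameter of the empty set 0 instead of -oo. *)
Definition diameter A : \bar R :=
  ereal_sup (0 |` [set (enorm (p.1 - p.2))%:E | p in A `*` A]).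

Definition hausdorff1_delta (delta : R) A : \bar R :=
  ereal_inf [set \sum_(k <oo) diameter (U k) | U in
    [set U : (set (R * R)) ^nat |
      (forall k, diameter (U k) <= delta%:E) /\ A `<=` \bigcup_k U k]].

Definition hausdorff1 A : \bar R :=
  ereal_sup [set hausdorff1_delta delta A | delta in [set d : R | (0 < d)%R]].

Lemma diameter_ge0 A : 0 <= diameter A.
Proof. by apply: ereal_sup_ubound; left. Qed.

Lemma diameter0 : diameter set0 = 0.
Proof.
apply/eqP; rewrite eq_le diameter_ge0 andbT.
by apply: ge_ereal_sup => _ [->|[p [[]]]].
Qed.

Lemma hausdorff1_delta_ge0 delta A : 0 <= hausdorff1_delta delta A.
Proof.
apply: le_ereal_inf_tmp => _ [U _ <-].
by apply: nneseries_ge0 => k _ _; exact: diameter_ge0.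
Qed.

Let gauge (delta : R) A : \bar R :=
  if diameter A <= delta%:E then diameter A else +oo.

Let discrete := g_sigma_algebraType [set: set (R * R)].

Let gauge_ge0 delta A : 0 <= gauge delta A.
Proof. by rewrite /gauge; case: ifP => // _; exact: diameter_ge0. Qed.

Let gauge0 delta : (0 < delta)%R -> gauge delta set0 = 0.
Proof. by move=> d0; rewrite /gauge diameter0 lee_fin ltW. Qed.

Let hausdorff1_deltaE delta A :
  hausdorff1_delta delta A = mu_ext (gauge delta : set discrete -> \bar R) A.
Proof.
apply/eqP; rewrite eq_le; apply/andP; split.
- apply: le_ereal_inf_tmp => _ [U [_ AU] <-].
  have [dU|] := pselect (forall k, diameter (U k) <= delta%:E).
    apply: ereal_inf_lbound; exists U => //.
    by apply: eq_eseriesr => k _; rewrite /gauge dU.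
  move=> /existsNP[k /negP dUk].
  rewrite (@eseries_pinfty _ _ xpredT k) ?leey//.
    by move=> n _; rewrite gt_eqF// (lt_le_trans (ltNyr 0%R))// gauge_ge0.
  by rewrite /gauge (negbTE dUk).
- apply: le_ereal_inf_tmp => _ [U [dU AU] <-].
  apply: ereal_inf_lbound; exists U.
    by split => // k; apply: sub_sigma_algebra.
  by apply: eq_eseriesr => k _; rewrite /gauge dU.
Qed.

Let hausdorff1_0 : hausdorff1 set0 = 0.
Proof.
apply/eqP; rewrite eq_le; apply/andP; split.
- apply: ge_ereal_sup => _ [d d0 <-].
  by rewrite hausdorff1_deltaE mu_ext0// ?gauge0// => ?; exact: gauge_ge0.
- apply: (@le_trans _ _ (hausdorff1_delta 1 set0)).
    exact: hausdorff1_delta_ge0.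
  by apply: ereal_sup_ubound; exists 1%R => //=.
Qed.

Let hausdorff1_ge0 A : 0 <= hausdorff1 A.
Proof.
apply: (@le_trans _ _ (hausdorff1_delta 1 A)); first exact: hausdorff1_delta_ge0.
by apply: ereal_sup_ubound; exists 1%R => //=.
Qed.

Let le_hausdorff1 : {homo hausdorff1 : A B / A `<=` B >-> A <= B}.
Proof.
move=> A B AB; apply: ge_ereal_sup => _ [d d0 <-].
apply: (@le_trans _ _ (hausdorff1_delta d B)).
  by rewrite !hausdorff1_deltaE le_mu_ext.
by apply: ereal_sup_ubound; exists d.
Qed.

Let hausdorff1_sigma_subadditive : sigma_subadditive hausdorff1.
Proof.
move=> F; apply: ge_ereal_sup => _ [d d0 <-].
rewrite hausdorff1_deltaE.
apply: le_trans (mu_ext_sigma_subadditive _ _) _; first exact: gauge_ge0.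
apply: lee_nneseries => [k _ _|k _].
  by rewrite -hausdorff1_deltaE; exact: hausdorff1_delta_ge0.
by rewrite -hausdorff1_deltaE; apply: ereal_sup_ubound; exists d.
Qed.

HB.instance Definition _ := isOuterMeasure.Build R (R * R)%type hausdorff1
  hausdorff1_0 hausdorff1_ge0 le_hausdorff1 hausdorff1_sigma_subadditive.

Definition hausdorff1_outer : {outer_measure set (R * R)%type -> \bar R} :=
  hausdorff1.

Definition H1 : {measure set (caratheodory_type hausdorff1_outer) -> \bar R} :=
  hausdorff1_outer : set (caratheodory_type hausdorff1_outer) -> \bar R.

Definition L2 :
    {measure set (measurableTypeR R * measurableTypeR R)%type -> \bar R} :=
  (@lebesgue_measure R \x @lebesgue_measure R)%E.

End hausdorff.

Arguments H1 R : clear implicits.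
Arguments L2 R : clear implicits.

(* Indices are shifted by one: Gamma_1, Gamma_2, Gamma_3 and
   Omega_1, Omega_2, Omega_3 are numbered 0, 1, 2.  With indices mod 3, the
   curve Gamma_i separates Omega_(i+1) from Omega_(i-1), and its normal points
   from Omega_(i+1), i.e. [ordS i], into Omega_(i-1), i.e. [ord_pred i].
   [curve i (t, s)] is a parametrization of Gamma_i(t) over s in [0, 1]. *)
Record network (R : realType) := Network {
  curve : 'I_3 -> R * R -> R * R ;
  phase : 'I_3 -> R -> set (R * R) ;
  normal : 'I_3 -> R -> R * R -> R * R }.

Section geometry.
Variable R : realType.
Implicit Types (Omega : set (R * R)) (nuO : R * R -> R * R) (N : network R).
Implicit Types (i j k : 'I_3) (t s T : R) (x : R * R).

(* Near x, Omega is to first order the half-plane of the v with n.v < 0; this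
   determines the unit vector n. *)
Definition is_outer_unit_normal Omega x (n : R * R) : Prop :=
  [/\ enorm n = 1,
    forall v, dot n v < 0 -> \forall e \near 0^'+, Omega (x + e *: v) &
    forall v, 0 < dot n v -> \forall e \near 0^'+, ~ Omega (x + e *: v)].

Record is_bounded_domain Omega nuO : Prop := {
  domain_open : open Omega ;
  domain_connected : connected Omega ;
  domain_nonempty : Omega !=set0 ;
  domain_bounded : bounded_set Omega ;
  domain_normal : forall x, frontier Omega x ->
    is_outer_unit_normal Omega x (nuO x) }.

Definition Gamma N i t : set (R * R) :=
  [set curve N i (t, s) | s in `[0, 1]].

Definition Gammas N t : set (R * R) := \bigcup_i Gamma N i t.

Definition chi N k t : R * R -> R := \1_(phase N k t).

Definition junctions N t : set (R * R) :=
  [set curve N ord0 (t, 0); curve N ord0 (t, 1)].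

Definition tangent N i (p : R * R) : R * R :=
  (enorm ('D_e2 (curve N i) p))^-1 *: 'D_e2 (curve N i) p.

(* d/ds tangent = d^2/ds^2 Id, where d/ds is the arclength derivative. *)
Definition curvature_vector N i (p : R * R) : R * R :=
  (enorm ('D_e2 (curve N i) p))^-1 *: 'D_e2 (tangent N i) p.

Definition curvature N i t s : R :=
  dot (curvature_vector N i (t, s)) (normal N i t (curve N i (t, s))).

Definition normal_velocity N i t s : R :=
  dot ('D_e1 (curve N i) (t, s)) (normal N i t (curve N i (t, s))).

(* [end1] selects the endpoint s = 1, otherwise s = 0. *)
Definition conormal N i t (end1 : bool) : R * R :=
  if end1 then tangent N i (t, 1) else - tangent N i (t, 0).

Definition weighted_length (sigma : 'I_3 -> R) N t : R :=
  \sum_(i < 3) sigma i * \int[H1 R]_(x in Gamma N i t) 1.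

(* C^1 in time and C^2 in space, up to the boundary of [0, T] x [0, 1]. *)
Definition regular_motion N T : Prop :=
  exists U : set (R * R), [/\ open U, `[0, T] `*` `[0, 1] `<=` U &
    forall i, C1_on U (curve N i) /\ C1_on U ('D_e2 (curve N i))].

Record is_network Omega N t : Prop := {
  curve_immersed : forall i s, s \in `[0, 1] -> 'D_e2 (curve N i) (t, s) <> 0 ;
  curve_injective : forall i, {in `[0, 1] &, injective (fun s => curve N i (t, s))} ;
  curve_start : forall i j, curve N i (t, 0) = curve N j (t, 0) ;
  curve_stop : forall i j, curve N i (t, 1) = curve N j (t, 1) ;
  curve_disjoint : forall i j, i != j ->
    Gamma N i t `&` Gamma N j t `<=` junctions N t ;
  curve_inside : forall i, Gamma N i t `<=` Omega ;
  phase_open : forall j, open (phase N j t) ;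
  phase_cover : \bigcup_j phase N j t = Omega `\` Gammas N t ;
  phase_disjoint : forall j k, j != k -> phase N j t `&` phase N k t = set0 ;
  phase_frontier : forall j, frontier (phase N j t) =
    Gamma N (ord_pred j) t `|` Gamma N (ordS j) t `|`
    (if j == ord_max then frontier Omega else set0) ;
  normal_unit : forall i x, Gamma N i t x -> enorm (normal N i t x) = 1 ;
  normal_orthogonal : forall i s, s \in `[0, 1] ->
    dot (normal N i t (curve N i (t, s))) ('D_e2 (curve N i) (t, s)) = 0 ;
  normal_continuous : forall i, {within Gamma N i t, continuous (normal N i t)} ;
  normal_oriented : forall i s, s \in `]0, 1[ ->
    let x := curve N i (t, s) in \forall e \near 0^'+,
      phase N (ordS i) t (x - e *: normal N i t x) /\
      phase N (ord_pred i) t (x + e *: normal N i t x) }.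

(* Integration by parts on the phase j.  Regularity up to the boundary excludes
   the triple junctions: if grad w extended continuously to a junction from the
   three phases, continuity of w and [grad w] nu = - V [chi] would force the
   junction to have velocity 0.  Square integrability of F still makes the
   flux through small circles around the junctions negligible. *)
Definition gauss_green Omega nuO N j t : Prop :=
  let D := phase N j t in
  let flux (F n : R * R -> R * R) x := dot (trace D F x) (n x) in
  let nu i := normal N i t in
  forall F : R * R -> R * R,
    C1_on D F ->
    (forall x, (closure D `\` junctions N t) x -> has_trace D F x) ->
    (L2 R).-integrable D (fun x => (enorm (F x) ^+ 2)%:E) ->
    (L2 R).-integrable D (fun x => (divergence F x)%:E) ->
    (forall i, i != j ->
      (H1 R).-integrable (Gamma N i t) (fun x => (flux F (nu i) x)%:E)) ->
    (j = ord_max ->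
      (H1 R).-integrable (frontier Omega) (fun x => (flux F nuO x)%:E)) ->
  \int[L2 R]_(x in D) divergence F x =
    \int[H1 R]_(x in Gamma N (ord_pred j) t) flux F (nu (ord_pred j)) x
    - \int[H1 R]_(x in Gamma N (ordS j) t) flux F (nu (ordS j)) x
    + (if j == ord_max then \int[H1 R]_(x in frontier Omega) flux F nuO x
       else 0).

Record is_regular Omega N (w : 'I_3 -> R * R -> R) t : Prop := {
  w_continuous : forall k, {within closure Omega, continuous (w k)} ;
  w_C2 : forall k, C2_on (Omega `\` Gammas N t) (w k) ;
  w_trace : forall j k x, (closure (phase N j t) `\` junctions N t) x ->
    has_trace (phase N j t) (grad (w k)) x ;
  w_energy : forall k,
    (L2 R).-integrable Omega (fun x => (enorm (grad (w k) x) ^+ 2)%:E) ;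
  w_flux : forall i j k, i != j ->
    (H1 R).-integrable (Gamma N i t)
      (fun x => (dot (trace (phase N j t) (grad (w k)) x) (normal N i t x))%:E) }.

Record mullins_sekerka Omega nuO (sigma : 'I_3 -> R) N
    (w : 'I_3 -> R * R -> R) t : Prop := {
  w_tangent : forall x, closure Omega x -> \sum_(k < 3) w k x = 0 ;
  w_harmonic : forall k x, (Omega `\` Gammas N t) x -> laplacian (w k) x = 0 ;
  gibbs_thomson : forall i s, s \in `]0, 1[ ->
    let x := curve N i (t, s) in let n := normal N i t x in
    \sum_(k < 3) w k x * jump (chi N k t) n x = sigma i * curvature N i t s ;
  interface_motion : forall i k s, s \in `]0, 1[ ->
    let x := curve N i (t, s) in let n := normal N i t x in
    dot (jump (grad (w k)) n x) n =
      - normal_velocity N i t s * jump (chi N k t) n x ;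
  neumann : forall k x, frontier Omega x ->
    dot (trace Omega (grad (w k)) x) (nuO x) = 0 ;
  young_law : forall end1,
    \sum_(i < 3) sigma i *: conormal N i t end1 = 0 }.

Record is_strong_solution Omega nuO (sigma : 'I_3 -> R) T
    (Gamma0 : set (R * R)) N (w : R -> 'I_3 -> R * R -> R) : Prop := {
  solution_motion : regular_motion N T ;
  solution_network : forall t, t \in `[0, T] -> is_network Omega N t ;
  solution_gauss_green : forall t j, t \in `[0, T] ->
    gauss_green Omega nuO N j t ;
  solution_regular : forall t, t \in `[0, T] -> is_regular Omega N (w t) t ;
  solution_equations : forall t, t \in `[0, T] ->
    mullins_sekerka Omega nuO sigma N (w t) t ;
  solution_initial : Gammas N 0 = Gamma0 }.

End geometry.

(* Main.v *)
Require Import Defs.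
From HB Require Import structures.
From mathcomp Require Import all_boot all_order all_algebra.
From mathcomp Require Import all_classical all_reals all_analysis.
From mathcomp Require Import measurable_realfun ring lra.

Set Implicit Arguments.
Unset Strict Implicit.
Unset Printing Implicit Defensive.
Import Order.TTheory GRing.Theory Num.Theory.
Import numFieldNormedType.Exports.
Local Open Scope classical_set_scope.
Local Open Scope ring_scope.

(** The weighted length changes at the rate at which curvature works against
normal velocity, and the same quantity is the Dirichlet energy of w.

Length.  With tau the unit tangent of a parametrized curve c(t, s), the speed
has time derivative tau . d_t d_s c.  Integration by parts in s gives
d/dt |Gamma_i| = [tau . d_t c] - int d_t c . d_s tau, and d_s tau is the speed
times the curvature vector (first_variation).  The three curves have the same
velocity at a junction, so that the boundary terms add up to this velocity times
the sum of the weighted conormals, which is 0 by Young's law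
(junction_balance).

Energy.  In each phase w_k is harmonic, hence w_k grad w_k has divergence
|grad w_k|^2, and the Gauss-Green formula expresses the energy of the phase by
fluxes through its boundary (dissipation_phase).  The outer boundary contributes
nothing because of the Neumann condition.  A curve Gamma_i is met from its two
sides with opposite signs, so that the jump of the normal derivative of w_k
remains (dissipation_interfaces).  The interface condition replaces this jump by
the normal velocity times the jump of chi_k, and summing w_k [chi_k] over k gives
sigma_i times the curvature (interface_flux).  Velocity and curvature vector are
paired through the normal only, which in the plane gives back their inner product
(dot_orthogonal), so the energy is the sum of the sigma_i int d_t c . d_s tau.

The two computations meet in integrals over [0, 1], whereas length and fluxes are
integrals with respect to Hausdorff measure.  They are compared by line_integral,
which rests on two facts: Borel sets are H1-measurable, by Caratheodory's
criterion (caratheodory_sublevel), and the measure of a short arc is its duration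
times the speed, up to a relative error that tends to 0 (H1_arc_near). *)

(** * Euclidean structure of the plane *)

Section euclidean.
Variable R : realType.
Implicit Types u v x y : R * R.

Lemma dotC u v : dot u v = dot v u.
Proof. by rewrite /dot mulrC [u.2 * _]mulrC. Qed.

Lemma dotDl u v x : dot (u + v) x = dot u x + dot v x.
Proof. by rewrite /dot /=; ring. Qed.

Lemma dotNl u x : dot (- u) x = - dot u x.
Proof. by case: u => a b; rewrite /dot /=; ring. Qed.

Lemma dotBl u v x : dot (u - v) x = dot u x - dot v x.
Proof. by rewrite dotDl dotNl. Qed.

Lemma dotZl (a : R) u x : dot (a *: u) x = a * dot u x.
Proof. by rewrite /dot mulrDr !mulrA. Qed.

Lemma dotZr (a : R) u x : dot u (a *: x) = a * dot u x.
Proof. by rewrite dotC dotZl dotC. Qed.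

Lemma dot0l x : dot 0 x = 0.
Proof. by rewrite /dot /= !mul0r addr0. Qed.

Lemma dot_suml (I : Type) (r : seq I) (P : pred I) (F : I -> R * R) x :
  dot (\sum_(i <- r | P i) F i) x = \sum_(i <- r | P i) dot (F i) x.
Proof.
by apply: (big_morph (fun u => dot u x)) => [u v|]; rewrite ?dotDl ?dot0l.
Qed.

Lemma dotuu_ge0 u : 0 <= dot u u.
Proof. by rewrite /dot -!expr2 addr_ge0// sqr_ge0. Qed.

Lemma enorm_ge0 u : 0 <= enorm u.
Proof. exact: sqrtr_ge0. Qed.

Lemma enorm_sqr u : enorm u ^+ 2 = dot u u.
Proof. by rewrite sqr_sqrtr// dotuu_ge0. Qed.

Lemma enorm0 : enorm (0 : R * R) = 0.
Proof. by rewrite /enorm dot0l sqrtr0. Qed.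

Lemma enormN u : enorm (- u) = enorm u.
Proof. by rewrite /enorm dotNl dotC dotNl opprK. Qed.

Lemma enormBC u v : enorm (u - v) = enorm (v - u).
Proof. by rewrite -enormN opprB. Qed.

Lemma enormZ (a : R) u : enorm (a *: u) = `|a| * enorm u.
Proof.
rewrite /enorm dotZl dotZr mulrA -expr2 sqrtrM ?sqr_ge0//.
by rewrite sqrtr_sqr.
Qed.

Lemma le_fst_enorm u : `|u.1| <= enorm u.
Proof. by rewrite -sqrtr_sqr ler_wsqrtr// /dot -!expr2 lerDl sqr_ge0. Qed.

Lemma le_snd_enorm u : `|u.2| <= enorm u.
Proof. by rewrite -sqrtr_sqr ler_wsqrtr// /dot -!expr2 lerDr sqr_ge0. Qed.

Lemma enorm_le_sum u : enorm u <= `|u.1| + `|u.2|.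
Proof.
rewrite -(@ler_pXn2r _ 2)// ?nnegrE ?enorm_ge0 ?addr_ge0//.
rewrite enorm_sqr /dot -!expr2 sqrrD !real_normK ?num_real//.
by rewrite lerD2r lerDl mulrn_wge0// mulr_ge0.
Qed.

Lemma enorm_eq0 u : enorm u = 0 -> u = 0.
Proof.
case: u => a b u0; apply/eqP; rewrite [_ == _]xpair_eqE.
by rewrite -!normr_le0 -u0 (le_fst_enorm (a, b)) (le_snd_enorm (a, b)).
Qed.

Lemma enorm_gt0 u : u <> 0 -> 0 < enorm u.
Proof.
by move=> u0; rewrite lt_neqAle enorm_ge0 andbT eq_sym; apply/eqP => /enorm_eq0.
Qed.

Lemma norm_dot_le u v : `|dot u v| <= enorm u * enorm v.
Proof.
rewrite -(@ler_pXn2r _ 2)// ?nnegrE ?mulr_ge0 ?enorm_ge0//.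
rewrite real_normK ?num_real// exprMn !enorm_sqr -subr_ge0.
rewrite (_ : _ - _ = (u.1 * v.2 - u.2 * v.1) ^+ 2) ?sqr_ge0//.
by rewrite /dot; ring.
Qed.

Lemma dot_le u v : dot u v <= enorm u * enorm v.
Proof. exact: le_trans (ler_norm _) (norm_dot_le u v). Qed.

Lemma enormD u v : enorm (u + v) <= enorm u + enorm v.
Proof.
rewrite -(@ler_pXn2r _ 2)// ?nnegrE ?addr_ge0 ?enorm_ge0//.
rewrite enorm_sqr sqrrD !enorm_sqr.
rewrite (_ : dot (u + v) _ = dot u u + dot u v *+ 2 + dot v v); last first.
  by rewrite /dot /=; ring.
by rewrite lerD2r lerD2l lerMn2r dot_le.
Qed.

Lemma enorm_continuous : continuous (@enorm R).
Proof.
move=> x; apply: (@continuous_comp _ _ _ (fun u => dot u u) Num.sqrt); last first.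
  exact: sqrt_continuous.
by apply: cvgD; apply: cvgM; (exact: cvg_fst || exact: cvg_snd).
Qed.

Lemma norm_le_enorm u : `|u| <= enorm u.
Proof. by rewrite prod_normE ge_max le_fst_enorm le_snd_enorm. Qed.

(** In the plane, n spans the line orthogonal to tau, which contains u; so u is
its own projection onto n. *)
Lemma dot_orthogonal (tau n u v : R * R) :
  tau <> 0 -> enorm n = 1 -> dot n tau = 0 -> dot u tau = 0 ->
  dot v n * dot u n = dot v u.
Proof.
move=> tau0 n1 ntau utau.
have n1' : n.1 ^+ 2 + n.2 ^+ 2 = 1.
  by have := enorm_sqr n; rewrite n1 expr1n /dot -!expr2.
have un : u.1 * n.2 - u.2 * n.1 = 0.
  have h1 : (u.1 * n.2 - u.2 * n.1) * tau.1 = 0.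
    transitivity (n.2 * dot u tau - u.2 * dot n tau); first by rewrite /dot; ring.
    by rewrite ntau utau !mulr0 subrr.
  have h2 : (u.1 * n.2 - u.2 * n.1) * tau.2 = 0.
    transitivity (u.1 * dot n tau - n.1 * dot u tau); first by rewrite /dot; ring.
    by rewrite ntau utau !mulr0 subrr.
  apply/eqP; case: (eqVneq (u.1 * n.2 - u.2 * n.1) 0) => // d0; exfalso.
  apply: tau0; rewrite [tau]surjective_pairing; apply/eqP.
  rewrite [_ == _]xpair_eqE.
  by move/eqP: h1; move/eqP: h2; rewrite !mulf_eq0 (negbTE d0) /= => -> ->.
rewrite -[RHS]mul1r -n1' /dot.
transitivity ((n.1 ^+ 2 + n.2 ^+ 2) * (v.1 * u.1 + v.2 * u.2) +
  (u.1 * n.2 - u.2 * n.1) * (v.2 * n.1 - v.1 * n.2)); first by ring.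
by rewrite un mul0r addr0.
Qed.

End euclidean.

(** * Hausdorff measure *)

Section hausdorff_measure.
Variable R : realType.
Implicit Types (A B X : set (R * R)) (p : R * R -> R).
Local Open Scope ereal_scope.

Lemma enorm_le_diameter A x y : A x -> A y ->
  (enorm (x - y))%:E <= diameter A.
Proof. by move=> Ax Ay; apply: ereal_sup_ubound; right; exists (x, y). Qed.

Lemma diameter_le A (r : R) : (0 <= r)%R ->
  (forall x y, A x -> A y -> (enorm (x - y) <= r)%R) -> diameter A <= r%:E.
Proof.
move=> r0 Ar; apply: ge_ereal_sup => _ [->|[[x y] [/= Ax Ay] <-]].
  by rewrite lee_fin.
by rewrite lee_fin Ar.
Qed.

Lemma hausdorff1_delta_le (d d' : R) A : (d <= d')%R ->
  hausdorff1_delta d' A <= hausdorff1_delta d A.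
Proof.
move=> dd'; apply: ereal_inf_le_tmp => _ [U [dU AU] <-].
exists U => //; split => // k.
by rewrite (le_trans (dU k))// lee_fin.
Qed.

Lemma hausdorff1_delta_ub (d : R) A : (0 < d)%R ->
  hausdorff1_delta d A <= hausdorff1 A.
Proof. by move=> d0; apply: ereal_sup_ubound; exists d. Qed.

(** A set of diameter at most d cannot meet both A and B, so that a cover of the
union splits into a cover of A and a cover of B. *)
Lemma hausdorff1_delta_separated (d r : R) A B : (d < r)%R ->
  (forall x y, A x -> B y -> (r <= enorm (x - y))%R) ->
  hausdorff1_delta d A + hausdorff1_delta d B <= hausdorff1_delta d (A `|` B).
Proof.
move=> dr AB; apply: le_ereal_inf_tmp => _ [U [dU ABU] <-].
pose V C k := if `[< U k `&` C !=set0 >] then U k else set0.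
have dV C k : diameter (V C k) <= diameter (U k).
  rewrite /V; case: ifP => // _; rewrite diameter0; exact: diameter_ge0.
have Vd C : C `<=` \bigcup_k U k ->
    hausdorff1_delta d C <= \sum_(k <oo) diameter (V C k).
  move=> CU; apply: ereal_inf_lbound; exists (V C) => //; split => [k|x Cx].
    exact: le_trans (dV C k) (dU k).
  have [k _ Ukx] := CU _ Cx; exists k => //.
  by rewrite /V asboolT//; exists x.
apply: le_trans (leeD (Vd A _) (Vd B _)) _.
- by apply: subset_trans ABU; left.
- by apply: subset_trans ABU; right.
rewrite -nneseriesD; [|by move=> *; exact: diameter_ge0..].
apply: lee_nneseries => k _.
  by rewrite adde_ge0 ?diameter_ge0.
have [UA|UA] := pselect (U k `&` A !=set0); last first.
  by rewrite {1}/V asboolF// diameter0 add0e.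
rewrite addeC {1}/V asboolF ?diameter0 ?add0e// => -[y [Uy By]].
case: UA => x [Ux Ax].
have := le_trans (enorm_le_diameter Ux Uy) (dU k).
by rewrite lee_fin leNgt (lt_le_trans dr)// AB.
Qed.

(** This is the property of a metric outer measure from which the measurability
of Borel sets follows. *)
Lemma hausdorff1_separated (r : R) A B : (0 < r)%R ->
  (forall x y, A x -> B y -> (r <= enorm (x - y))%R) ->
  hausdorff1 A + hausdorff1 B <= hausdorff1 (A `|` B).
Proof.
move=> r0 AB.
have key (d1 d2 : R) : (0 < d1)%R -> (0 < d2)%R ->
    hausdorff1_delta d1 A + hausdorff1_delta d2 B <= hausdorff1 (A `|` B).
  move=> d10 d20; pose d := Num.min (Num.min d1 d2) (r / 2)%R.
  have d0 : (0 < d)%R by rewrite !lt_min d10 d20 divr_gt0.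
  apply: le_trans (hausdorff1_delta_ub (A `|` B) d0).
  apply: le_trans (@hausdorff1_delta_separated d r A B _ AB); last first.
    by rewrite /d !gt_min (_ : (r / 2 < r)%R) ?orbT//; lra.
  by apply: leeD; apply: hausdorff1_delta_le; rewrite /d !ge_min lexx ?orbT.
have h0 (d : R) C : 0 <= hausdorff1_delta d C := hausdorff1_delta_ge0 d C.
have [->|ABoo] := eqVneq (hausdorff1 (A `|` B)) +oo; first exact: leey.
have {}ABoo : hausdorff1 (A `|` B) < +oo by rewrite ltey.
have key2 (d2 : R) : (0 < d2)%R ->
    hausdorff1 A + hausdorff1_delta d2 B <= hausdorff1 (A `|` B).
  move=> d20; have Bfin : hausdorff1_delta d2 B \is a fin_num.
    rewrite ge0_fin_numE//; apply: (le_lt_trans _ ABoo).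
    by apply: le_trans (key 1%R d2 _ _) => //; rewrite leeDr.
  rewrite -leeBrDr//; apply: ge_ereal_sup => _ [d1 d10 <-].
  by rewrite leeBrDr// key.
have Afin : hausdorff1 A \is a fin_num.
  rewrite ge0_fin_numE ?outer_measure_ge0//.
  apply: (le_lt_trans _ ABoo).
  by apply: le_trans (key2 1%R _) => //; rewrite leeDl.
rewrite addeC -leeBrDr//; apply: ge_ereal_sup => _ [d1 d10 <-].
by rewrite leeBrDr// addeC key2.
Qed.

End hausdorff_measure.

Section hausdorff_borel.
Variable R : realType.
Implicit Types (A B X : set (R * R)) (p : R * R -> R).
Local Open Scope ereal_scope.

Lemma hausdorff1_separated_levels p (a b : R) A B : (a < b)%R ->
  (forall x y, `|p x - p y| <= enorm (x - y))%R ->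
  (forall x, A x -> p x <= a)%R -> (forall x, B x -> b <= p x)%R ->
  hausdorff1 A + hausdorff1 B <= hausdorff1 (A `|` B).
Proof.
move=> ab pL Aa Bb; apply: (@hausdorff1_separated _ (b - a)%R).
  by rewrite subr_gt0.
move=> x y Ax By; rewrite (le_trans _ (pL x y))// distrC.
by rewrite (le_trans _ (ler_norm _))// lerB ?Aa ?Bb.
Qed.

(** Caratheodory's criterion.  The part of X where p is small and positive is
cut into strips.  Strips that are not adjacent are separated, so the measures of
the strips are summable, and the strips close to the level set contribute
little; away from them X is separated from the sublevel set. *)
Lemma caratheodory_sublevel p :
  (forall x y, `|p x - p y| <= enorm (x - y))%R ->
  caratheodory_measurable (@hausdorff1 R) [set x | (p x <= 0)%R].
Proof.
move=> pL; apply: (@le_caratheodory_measurable R _ (hausdorff1_outer R)) => X.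
rewrite /hausdorff1_outer /=; set C := [set x | _].
have [->|Xoo] := eqVneq (hausdorff1 X) +oo; first exact: leey.
have {}Xoo : hausdorff1 X < +oo by rewrite ltey.
have le_h A B : A `<=` B -> hausdorff1 A <= hausdorff1 B.
  exact: (le_outer_measure (hausdorff1_outer R)).
have h_ge0 A : 0 <= hausdorff1 A := outer_measure_ge0 (hausdorff1_outer R) A.
pose c (n : nat) : R := (n.+1%:R^-1)%R.
have c0 n : (0 < c n)%R by rewrite invr_gt0 ltr0n.
have cS n : (c n.+1 < c n)%R by rewrite /c ltf_pV2 ?posrE ?ltr0n// ltr_nat.
have c_le m n : (m <= n)%N -> (c n <= c m)%R.
  by move=> mn; rewrite /c lef_pV2 ?posrE ?ltr0n// ler_nat.
pose U n := X `&` [set x | (c n <= p x)%R].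
pose S n := X `&` [set x | (c n.+1 <= p x < c n)%R].
(* The strip S n separates S n.+1 from U n. *)
have sumS n : \sum_(0 <= i < n) hausdorff1 (S i.+1) <=
    hausdorff1 (U n.+1) + hausdorff1 (U n).
  elim: n => [|n ih]; first by rewrite big_geq// adde_ge0.
  rewrite big_nat_recr//=; apply: (le_trans (leeD2r _ ih)).
  rewrite -addeA [leRHS]addeC; apply: leeD => //.
  rewrite addeC; pose m := ((c n + c n.+1) / 2)%R.
  have [m1 m2] : (c n.+1 < m /\ m < c n)%R.
    by have := cS n; rewrite /m; split; lra.
  apply: le_trans (@hausdorff1_separated_levels p m (c n) _ _ m2 pL _ _) _.
  - by move=> x [_ /= /andP[_ /ltW/le_trans]]; apply; exact: ltW.
  - by move=> x [].
  apply: le_h => x [[Xx /= /andP[cx _]]|[Xx /= cx]]; split => //=.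
  by rewrite (le_trans _ cx)// c_le// ltnW.
have sumSoo : \sum_(0 <= i <oo) hausdorff1 (S i.+1) < +oo.
  apply: (@le_lt_trans _ _ (hausdorff1 X + hausdorff1 X)); last first.
    by rewrite lte_add_pinfty.
  apply: lime_le; first exact: is_cvg_nneseries.
  apply: nearW => n; apply: (le_trans (sumS n)).
  by apply: leeD; apply: le_h => x [].
have tail := nneseries_tail_cvg sumSoo (fun k _ => h_ge0 (S k.+1)).
have lim : hausdorff1 X + \sum_(n <= i <oo) hausdorff1 (S i.+1) @[n --> \oo]
    --> hausdorff1 X + 0.
  by apply: cvgeD => //; [rewrite fin_num_adde_defl|exact: cvg_cst].
rewrite -[leRHS]adde0; apply: (cvge_ge _ lim); apply: nearW => n.
have cover : X `&` ~` C `<=`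
    U n.+1 `|` \bigcup_(k in ~` `I_n) S k.+1.
  move=> x [Xx /negP]; rewrite -ltNge => px.
  have [cx|cx] := leP (c n.+1) (p x); first by left.
  right; have ex : exists m, (c m <= p x)%R.
    exists (Num.truncn (p x)^-1); rewrite /c invf_ple ?posrE//.
    by rewrite ltW// truncnS_gt.
  case: (ex_minnP ex) => m cm mmin.
  have nm : (n.+1 < m)%N.
    by rewrite ltnNge; apply/negP => /c_le/le_trans/(_ cm); rewrite leNgt cx.
  case: m => [//|[//|m]] in cm mmin nm *.
  exists m => //=; first by apply/negP; rewrite -leqNgt.
  split => //=; rewrite cm /= ltNge; apply/negP => /mmin.
  by rewrite ltnn.
apply: (@le_trans _ _ (hausdorff1 (X `&` C) + (hausdorff1 (U n.+1) +
    \sum_(n <= i <oo) hausdorff1 (S i.+1)))).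
  apply: leeD => //; apply: (le_trans (le_h _ _ cover)).
  apply: (le_trans (outer_measureU2 (hausdorff1_outer R) _ _)).
  apply: leeD => //.
  exact: (outer_measure_sigma_subadditive_tail (hausdorff1_outer R) n
    (fun k => S k.+1)).
rewrite addeA; apply: leeD => //.
apply: le_trans (@hausdorff1_separated_levels p 0%R (c n.+1) _ _ _ pL _ _) _.
- exact: c0.
- by move=> x [].
- by move=> x [].
by apply: le_h => x [[]|[]].
Qed.

End hausdorff_borel.

(** * Borel sets of the plane *)

Section borel.
Variable R : realType.

(** Open sets are countable unions of boxes with rational vertices. *)
Lemma measurable_preimage_open d (T : measurableType d) (p : T -> R * R) :
  measurable_fun setT (fst \o p) -> measurable_fun setT (snd \o p) ->
  forall U, open U -> measurable (p @^-1` U).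
Proof.
move=> p1 p2 U oU.
pose box (q : (rat * rat) * (rat * rat)) : set (R * R) :=
  `]ratr q.1.1, ratr q.1.2[%classic `*` `]ratr q.2.1, ratr q.2.2[%classic.
pose F q := if `[< box q `<=` U >] then p @^-1` (box q) else set0.
rewrite (_ : p @^-1` U = \bigcup_q F q); last first.
  apply/seteqP; split => [x /= Ux|x [q _]]; last first.
    by rewrite /F; case: asboolP => // qU; exact: qU.
  have /nbhs_ballP[e /= e0 eU] : nbhs (p x) U by exact: open_nbhs_nbhs.
  have ex (y : R) : exists q : rat * rat,
      (y \in `]ratr q.1, ratr q.2[) /\ (`]ratr q.1, ratr q.2[%classic `<=` ball y e).
    have [ye1 ye2] : y - e < y /\ y < y + e by rewrite gtrBl ltrDl.
    have [q1] := rat_in_itvoo ye1; have [q2] := rat_in_itvoo ye2.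
    rewrite !in_itv /= => /andP[h3 h4] /andP[h1 h2].
    exists (q1, q2); rewrite in_itv /= h2 h3; split => // z /=.
    rewrite in_itv /= => /andP[z1 z2].
    by rewrite /ball/= ltr_distlC; lra.
  have [q1 [x1 q1U]] := ex (p x).1; have [q2 [x2 q2U]] := ex (p x).2.
  exists (q1, q2) => //; rewrite /F asboolT//=.
  move=> [y1 y2] [/= h1 h2]; apply: eU; split; [exact: q1U|exact: q2U].
apply: countable_bigcupT_measurable; first exact: countableP.
move=> q; rewrite /F; case: ifP => // _.
rewrite (_ : _ @^-1` _ =
  (setT `&` (fst \o p) @^-1` `]ratr q.1.1, ratr q.1.2[%classic) `&`
  (setT `&` (snd \o p) @^-1` `]ratr q.2.1, ratr q.2.2[%classic)); last first.
  by apply/seteqP; split => [x []//|x [[_ ?] [_ ?]]].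
by apply: measurableI; [exact: p1|exact: p2].
Qed.

(** The product sigma-algebra of L2 and the Caratheodory sigma-algebra of H1
both contain the open sets; what follows from this is shown once for a map p,
which is the identity in both cases. *)
Definition borel_plane d (T : measurableType d) (p : T -> R * R) :=
  forall U, open U -> measurable (p @^-1` U).

Lemma within_continuous_measurable d (T : measurableType d) (p : T -> R * R)
    (D : set (R * R)) (f : R * R -> R) :
  borel_plane p -> measurable (p @^-1` D) -> {within D, continuous f} ->
  measurable_fun (p @^-1` D) (f \o p).
Proof.
move=> bp mD cf; apply: (measurability _ (RGenOInfty.measurableE R)).
move=> _ [_ [a ->] <-].
move: cf => /continuousP cf; have /open_subspaceP[V oV VD] := cf _ (rray_open a).
rewrite (_ : _ `&` _ = p @^-1` D `&` p @^-1` V).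
  by apply: measurableI => //; exact: bp.
transitivity (p @^-1` (D `&` f @^-1` `]a, +oo[%classic)) => //.
by rewrite setIC -VD setIC.
Qed.

Lemma borel_L2 : borel_plane (fun x : measurableTypeR R * measurableTypeR R => x).
Proof.
by apply: measurable_preimage_open; [exact: measurable_fst|exact: measurable_snd].
Qed.

(** Coordinates are 1-Lipschitz, so Caratheodory's criterion makes half-planes
measurable. *)
Lemma borel_H1 : borel_plane (fun x : caratheodory_type (hausdorff1_outer R) => x).
Proof.
have half (q : R * R -> R) : (forall x y, `|q x - q y| <= enorm (x - y)) ->
    measurable_fun [set: caratheodory_type (hausdorff1_outer R)] q.
  move=> qL; apply: (measurability _ (RGenOInfty.measurableE R)).
  move=> _ [_ [a ->] <-]; rewrite setTI.
  rewrite (_ : _ @^-1` _ = ~` [set x | q x - a <= 0]); last first.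
    apply/seteqP; split => [x|x] /=; rewrite in_itv /= andbT subr_le0.
      by rewrite ltNge => /negP.
    by move/negP; rewrite -ltNge.
  apply: measurableC; apply: caratheodory_sublevel => x y.
  by rewrite opprD addrACA subrr addr0.
apply: measurable_preimage_open; apply: half => x y.
  exact: (le_fst_enorm (x - y)).
exact: (le_snd_enorm (x - y)).
Qed.

End borel.

(** * Length and area of arcs *)

Section arcs.
Variable R : realType.
Implicit Types (A B : set (R * R)) (c : R -> R * R) (a b L : R).

Lemma nneseries_le_card (u : (\bar R)^nat) n (x : R) : 0 <= x ->
  (forall k, 0 <= u k)%E ->
  (forall k, u k <= (if (k < n)%N then x else 0)%:E)%E ->
  (\sum_(k <oo) u k <= (n%:R * x)%:E)%E.
Proof.
move=> x0 u0 un; apply: lime_le; first exact: is_cvg_nneseries.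
apply: nearW => m.
have : (\sum_(0 <= k < m) u k <= ((minn m n)%:R * x)%:E)%E.
  elim: m => [|m ih]; first by rewrite big_geq// min0n mul0r.
  rewrite big_nat_recr//=; apply: (le_trans (leeD ih (un m))).
  rewrite -EFinD lee_fin; case: ltnP => mn.
    by rewrite !(minn_idPl _)// ?(ltnW mn)// -natr1; lra.
  by rewrite addr0 !(minn_idPr _)// leqW.
move=> /le_trans; apply.
by rewrite lee_fin ler_wpM2r// ler_nat geq_minr.
Qed.

Lemma itv_pieces a b n s : a <= b -> s \in `[a, b] ->
  let h := (b - a) / n.+1%:R in
  exists2 k, (k < n.+1)%N & s \in `[a + k%:R * h, a + k.+1%:R * h].
Proof.
move=> ab + h; rewrite in_itv/= => /andP[as_ sb].
have h0 : 0 <= h by rewrite divr_ge0 ?subr_ge0.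
have hb : a + n.+1%:R * h = b by rewrite /h mulrC divfK ?pnatr_eq0//; lra.
have ex : exists k, s <= a + k.+1%:R * h by exists n; rewrite hb.
case: (ex_minnP ex) => k sk kmin; exists k; first by rewrite ltnS kmin// hb.
rewrite in_itv/= sk andbT; case: k => [|k] in sk kmin *; first by lra.
rewrite leNgt; apply/negP => /ltW/kmin; by rewrite ltnn.
Qed.

Lemma itv_piece_sub a b n k : a <= b -> (k < n.+1)%N ->
  let h := (b - a) / n.+1%:R in
  `[a + k%:R * h, a + k.+1%:R * h] `<=` `[a, b].
Proof.
move=> ab kn h s /=; rewrite !in_itv/= => /andP[h1 h2].
have h0 : 0 <= h by rewrite divr_ge0 ?subr_ge0.
have hb : a + n.+1%:R * h = b by rewrite /h mulrC divfK ?pnatr_eq0//; lra.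
apply/andP; split; first by apply: (le_trans _ h1); rewrite lerDl mulr_ge0.
by apply: (le_trans h2); rewrite -hb lerD2l ler_wpM2r// ler_nat.
Qed.

Definition lipschitz_arc a b L c := forall s r,
  s \in `[a, b] -> r \in `[a, b] -> enorm (c s - c r) <= L * `|s - r|.

Lemma lipschitz_arc_continuous a b L c : lipschitz_arc a b L c ->
  {within `[a, b], continuous c}.
Proof.
move=> cL; apply/subspace_continuousP => s sab.
have L0 : 0 < `|L| + 1 by rewrite ltr_wpDl.
apply/cvgrPdist_le => e e0; rewrite near_withinE.
near=> r => rab; rewrite (le_trans (norm_le_enorm _))//.
rewrite (le_trans (cL _ _ sab rab))//.
apply: (@le_trans _ _ ((`|L| + 1) * `|s - r|)).
  by rewrite ler_wpM2r// (le_trans (ler_norm L))// lerDl.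
rewrite mulrC -ler_pdivlMr//.
near: r; apply: (@cvgr_dist_le _ _ _ (nbhs s) _ id s) => //.
by rewrite divr_gt0.
Unshelve. all: by end_near. Qed.

Lemma arc_compact a b L c : lipschitz_arc a b L c -> compact (c @` `[a, b]).
Proof.
move=> cL; apply: continuous_compact; last exact: segment_compact.
exact: lipschitz_arc_continuous cL.
Qed.

Lemma closed_measurable_plane d (T : measurableType d) (p : T -> R * R) A :
  borel_plane p -> closed A -> measurable (p @^-1` A).
Proof.
move=> bp /closed_openC/bp/measurableC.
by rewrite -preimage_setC setCK.
Qed.

Lemma hausdorff_plane : hausdorff_space (R * R)%type.
Proof. exact: norm_hausdorff. Qed.

Lemma arc_measurable_H1 a b L c : lipschitz_arc a b L c ->
  measurable (c @` `[a, b] : set (caratheodory_type (hausdorff1_outer R))).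
Proof.
move=> /arc_compact/(compact_closed hausdorff_plane).
exact: (closed_measurable_plane (@borel_H1 R)).
Qed.

Lemma arc_measurable_L2 a b L c : lipschitz_arc a b L c ->
  measurable (c @` `[a, b] : set (measurableTypeR R * measurableTypeR R)).
Proof.
move=> /arc_compact/(compact_closed hausdorff_plane).
exact: (closed_measurable_plane (@borel_L2 R)).
Qed.

Lemma H1_arc_le a b L c : a <= b -> 0 <= L -> lipschitz_arc a b L c ->
  (H1 R (c @` `[a, b]) <= (L * (b - a))%:E)%E.
Proof.
move=> ab L0 cL; apply: ge_ereal_sup => _ [d /= d0 <-].
pose n := Num.truncn (L * (b - a) / d); pose h := (b - a) / n.+1%:R.
have h0 : 0 <= h by rewrite divr_ge0 ?subr_ge0.
have Lh : L * h <= d.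
  rewrite /h mulrA ler_pdivrMr ?ltr0n// [d * _]mulrC -ler_pdivrMr//.
  by apply/ltW; exact: truncnS_gt.
pose U k : set (R * R) := if (k < n.+1)%N then
  c @` `[a + k%:R * h, a + k.+1%:R * h] else set0.
(* The choice of n makes the pieces U k shorter than d. *)
have dU k : (diameter (U k) <= (if (k < n.+1)%N then L * h else 0)%:E)%E.
  rewrite /U; case: ifPn => kn; last by rewrite diameter0.
  apply: diameter_le; first by rewrite mulr_ge0.
  move=> _ _ [s /= sk <-] [r /= rk <-].
  rewrite (le_trans (cL _ _ _ _))//; try exact: (itv_piece_sub ab kn).
  rewrite ler_wpM2l// ler_norml; move: sk rk; rewrite !in_itv/=.
  by rewrite -natr1 mulrDl mul1r; lra.
have -> : L * (b - a) = n.+1%:R * (L * h).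
  by rewrite /h mulrCA [n.+1%:R * _]mulrC divfK ?pnatr_eq0.
apply: (@le_trans _ _ (\sum_(k <oo) diameter (U k))%E).
  apply: ereal_inf_lbound; exists U => //; split => [k|_ [s /= sab <-]].
    by apply: (le_trans (dU k)); rewrite lee_fin; case: ifP => // _; exact: ltW.
  have [k kn sk] := itv_pieces n ab sab.
  by exists k => //; rewrite /U kn; exists s.
apply: nneseries_le_card => //; first by rewrite mulr_ge0.
by move=> k; exact: diameter_ge0.
Qed.

(** Orthogonal projection onto the chord does not increase diameters, and maps
an arc onto a set that contains the chord. *)
Lemma H1_arc_ge a b c : a <= b -> {within `[a, b], continuous c} ->
  ((enorm (c b - c a))%:E <= H1 R (c @` `[a, b]))%E.
Proof.
move=> ab cc.
have [->|ne] := pselect (c b - c a = 0).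
  by rewrite enorm0; exact: (outer_measure_ge0 (hausdorff1_outer R)).
set L := enorm _; have L0 : 0 < L := enorm_gt0 ne.
pose v := L^-1 *: (c b - c a); pose p (x : R * R) := dot (x - c a) v.
have v1 : enorm v = 1.
  by rewrite enormZ gtr0_norm ?invr_gt0// mulVf// gt_eqF.
have pL x y : `|p x - p y| <= enorm (x - y).
  rewrite /p -dotBl opprB addrA subrK (le_trans (norm_dot_le _ _))//.
  by rewrite v1 mulr1.
have pa : p (c a) = 0 by rewrite /p subrr dot0l.
have pb : p (c b) = L.
  by rewrite /p dotZr -enorm_sqr -/L expr2 mulKf// gt_eqF.
have pc : continuous p.
  move=> x; apply/cvgrPdist_le => e e0; near=> y.
  rewrite (le_trans (pL _ _))// (le_trans (enorm_le_sum _))//.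
  rewrite [e]splitr lerD//; near: y.
    apply: (@cvgr_dist_le _ _ _ (nbhs x) _ fst x.1); last by rewrite divr_gt0.
    exact: cvg_fst.
  apply: (@cvgr_dist_le _ _ _ (nbhs x) _ snd x.2); last by rewrite divr_gt0.
  exact: cvg_snd.
apply: le_trans (_ : _ <= hausdorff1_delta 1 _)%E _; last first.
  exact: hausdorff1_delta_ub.
apply: le_ereal_inf_tmp => _ [U [dU cU] <-].
(* I k is a measurable set that contains p (U k), no longer than U k is wide. *)
pose I k : set R := if U k == set0 then set0 else
  `[inf (p @` U k), inf (p @` U k) + fine (diameter (U k))]%classic.
have Ufin k : diameter (U k) \is a fin_num.
  by rewrite ge0_fin_numE ?diameter_ge0// (le_lt_trans (dU k))// ltry.
have mI k : measurable (I k).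
  by rewrite /I; case: ifP => // _; exact: measurable_itv.
have lI k : (lebesgue_measure (I k) <= diameter (U k))%E.
  rewrite /I; case: ifPn => _; first by rewrite measure0 diameter_ge0.
  rewrite lebesgue_measure_itv/=; case: ifP => _; last exact: diameter_ge0.
  by rewrite -EFinB addrAC subrr add0r fineK.
have pU k x y : U k x -> U k y -> `|p x - p y| <= fine (diameter (U k)).
  move=> Ux Uy; rewrite (le_trans (pL _ _))// -lee_fin fineK//.
  exact: enorm_le_diameter.
have sub : `[0, L]%classic `<=` \bigcup_k I k.
  move=> r /=; rewrite in_itv/= => /andP[r0 rL].
  have [||s sab ps] := @IVT R (p \o c) a b r ab.
  - by move=> z; apply: (@continuous_comp (subspace _) _ _ c p); [exact: cc|exact: pc].
  - by rewrite /= pa pb min_l ?(ltW L0)// max_r ?(ltW L0)// r0.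
  have [k _ Uk] : (\bigcup_k U k) (c s) by apply: cU; exists s.
  exists k => //; rewrite /I ifF; last by apply/eqP => U0; rewrite U0 in Uk.
  rewrite -ps /= in_itv/=.
  have bd : has_lbound (p @` U k).
    exists (p (c s) - fine (diameter (U k))) => _ [y Uy <-].
    by have := pU k _ _ Uk Uy; rewrite ler_norml; lra.
  apply/andP; split; first by apply: ge_inf => //; exists (c s).
  rewrite -lerBlDr; apply: lb_le_inf; first by exists (p (c s)), (c s).
  move=> _ [y Uy <-].
  by have := pU k _ _ Uk Uy; rewrite ler_norml; lra.
have := @measure_sigma_subadditive_tail _ _ _ (@lebesgue_measure R) _ _ 0%N mI
  (measurable_itv `[0, L]).
rewrite (_ : ~` `I_0 = setT); last by apply/seteqP; split.
move=> /(_ sub); rewrite /= lebesgue_measure_itv/= lte_fin L0 -EFinB subr0.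
move=> /le_trans; apply; apply: lee_nneseries => // k _ _.
Unshelve. all: by end_near. Qed.

Lemma H1_point (x : R * R) : H1 R [set x] = 0%E.
Proof.
apply/eqP; rewrite eq_le; apply/andP; split; last first.
  exact: (outer_measure_ge0 (hausdorff1_outer R)).
rewrite (_ : [set x] = (fun=> x) @` `[0, 0 : R]); last first.
  by apply/seteqP; split => [_ ->|_ [_ _ <-]//]; exists 0 => //=; rewrite in_itv/= lexx.
rewrite (le_trans (@H1_arc_le 0 0 0 _ _ _ _))// ?mul0r// => s r _ _.
by rewrite subrr enorm0 mul0r.
Qed.

Lemma measurable_point (x : R * R) :
  measurable ([set x] : set (caratheodory_type (hausdorff1_outer R))).
Proof.
apply: (@closed_measurable_plane _ _ _ [set x] (@borel_H1 R)).
exact: (accessible_closed_set1 (hausdorff_accessible hausdorff_plane)).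
Qed.

(** The arc is covered by squares, of number n and side of order 1 / n. *)
Lemma L2_arc a b L c : a <= b -> 0 <= L -> lipschitz_arc a b L c ->
  L2 R (c @` `[a, b]) = 0%E.
Proof.
move=> ab L0 cL; apply/eqP; rewrite eq_le measure_ge0 andbT.
apply/lee_addgt0Pr => e e0; rewrite add0e.
(* The n.+1 squares Q k below, of side 2 L h, have total area M / n.+1. *)
pose M := 4 * (L * (b - a)) ^+ 2.
have M0 : 0 <= M by rewrite mulr_ge0// sqr_ge0.
pose n := Num.truncn (M / e); pose h := (b - a) / n.+1%:R.
have h0 : 0 <= h by rewrite divr_ge0 ?subr_ge0.
have Lh0 : 0 <= L * h by rewrite mulr_ge0.
pose I (y : R) : set (measurableTypeR R) := `[y - L * h, y + L * h]%classic.
have mI y : measurable (I y) by exact: measurable_itv.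
have lI y : (@lebesgue_measure R (I y) <= (2 * (L * h))%:E)%E.
  rewrite lebesgue_measure_itv/=; case: ifP => _; last by rewrite lee_fin; lra.
  by rewrite -EFinB lee_fin; lra.
pose x k := c (a + k%:R * h).
pose Q k : set (measurableTypeR R * measurableTypeR R) :=
  if (k < n.+1)%N then I (x k).1 `*` I (x k).2 else set0.
have mQ k : measurable (Q k).
  by rewrite /Q; case: ifP => // _; exact: measurableX.
have lQ k : (L2 R (Q k) <= (if (k < n.+1)%N then (2 * (L * h)) ^+ 2 else 0)%:E)%E.
  rewrite /Q; case: ifP => // _; last by rewrite measure0.
  have -> : L2 R (I (x k).1 `*` I (x k).2) =
      (lebesgue_measure (I (x k).1) * lebesgue_measure (I (x k).2))%E.
    exact: product_measure1E.
  by rewrite expr2 EFinM; apply: lee_pmul.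
have sub : c @` `[a, b] `<=` \bigcup_(k in ~` `I_0) Q k.
  move=> _ [s /= sab <-]; have [k kn sk] := itv_pieces n ab sab.
  exists k => //; rewrite /Q kn.
  have := cL _ (a + k%:R * h) sab; rewrite -/(x k).
  have kh : a + k%:R * h \in `[a, b].
    apply: (itv_piece_sub ab kn) => /=; rewrite in_itv/= lexx lerD2l.
    by rewrite ler_wpM2r// ler_nat.
  move=> /(_ kh) sx.
  have {}sx : enorm (c s - x k) <= L * h.
    rewrite (le_trans sx)// ler_wpM2l// ler_norml; move: sk; rewrite in_itv/=.
    by rewrite -/h -natr1 mulrDl mul1r; lra.
  have := le_trans (le_fst_enorm _) sx; have := le_trans (le_snd_enorm _) sx.
  rewrite !ler_norml /= => /andP[? ?] /andP[? ?].
  by split; rewrite /I /= in_itv/=; apply/andP; split; lra.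
have := @measure_sigma_subadditive_tail _ _ _ (L2 R) _ _ 0%N mQ
  (arc_measurable_L2 cL) sub.
move=> /le_trans; apply.
apply: (le_trans (nneseries_le_card _ _ lQ)) => //; first by rewrite sqr_ge0.
rewrite lee_fin (_ : n.+1%:R * _ = M / n.+1%:R).
  rewrite ler_pdivrMr ?ltr0n// [e * _]mulrC -ler_pdivrMr//.
  by apply/ltW; exact: truncnS_gt.
by rewrite /M /h; field; rewrite ?natr1 ?nat1r pnatr_eq0.
Qed.

End arcs.

(** * Differentiation of plane-valued functions *)

Section calculus.
Variable R : realType.

Lemma cvg_is_derive (V W : normedModType R) (f : V -> W) (x v : V) (df : W) :
  h^-1 *: (f (h *: v + x) - f x) @[h --> 0^'] --> df -> is_derive x v f df.
Proof.
by move=> fdf; split; [apply/cvg_ex; exists df|exact: cvg_lim].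
Qed.

Lemma is_derive_cvg (V W : normedModType R) (f : V -> W) (x v : V) (df : W) :
  is_derive x v f df -> h^-1 *: (f (h *: v + x) - f x) @[h --> 0^'] --> df.
Proof. by move=> [fx <-]; exact: fx. Qed.

Variables (V : normedModType R) (x v : V).

Lemma is_derive_fst (f : V -> R * R) df :
  is_derive x v f df -> is_derive x v (fun y => (f y).1) df.1.
Proof.
move=> /is_derive_cvg fdf; apply: cvg_is_derive.
exact: (cvg_comp _ fst fdf (@cvg_fst _ _ (nbhs df.1) (nbhs df.2) _)).
Qed.

Lemma is_derive_snd (f : V -> R * R) df :
  is_derive x v f df -> is_derive x v (fun y => (f y).2) df.2.
Proof.
move=> /is_derive_cvg fdf; apply: cvg_is_derive.
exact: (cvg_comp _ snd fdf (@cvg_snd _ _ (nbhs df.1) (nbhs df.2) _)).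
Qed.

Lemma is_derive_pair (f g : V -> R) df dg :
  is_derive x v f df -> is_derive x v g dg ->
  is_derive x v (fun y => (f y, g y) : R * R) (df, dg).
Proof.
move=> /is_derive_cvg fdf /is_derive_cvg gdg; apply: cvg_is_derive.
exact: cvg_pair fdf gdg.
Qed.

Lemma is_derive_dot (f g : V -> R * R) df dg :
  is_derive x v f df -> is_derive x v g dg ->
  is_derive x v (fun y => dot (f y) (g y)) (dot df (g x) + dot (f x) dg).
Proof.
move=> fdf gdg.
have f1 := is_derive_fst fdf; have f2 := is_derive_snd fdf.
have g1 := is_derive_fst gdg; have g2 := is_derive_snd gdg.
apply: (is_derive_eq (is_deriveD (is_deriveM f1 g1) (is_deriveM f2 g2))).
by rewrite /dot /GRing.scale /=; ring.
Qed.

Lemma is_derive_scale (k : V -> R) (f : V -> R * R) dk df :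
  is_derive x v k dk -> is_derive x v f df ->
  is_derive x v (fun y => k y *: f y) (dk *: f x + k x *: df).
Proof.
move=> kd fd; have f1 := is_derive_fst fd; have f2 := is_derive_snd fd.
apply: (is_derive_eq (is_derive_pair (is_deriveM kd f1) (is_deriveM kd f2))).
rewrite [RHS]surjective_pairing /=.
by congr (_, _); rewrite /GRing.scale /=; ring.
Qed.

End calculus.

Section arcs_smooth.
Variables (R : realType).
Implicit Types (c dc : R -> R * R) (a b L : R).

(** The mean value inequality for plane curves, from the mean value theorem
for the component along the chord. *)
Lemma derive_lipschitz_arc a b L c dc :
  (forall s, s \in `[a, b] -> is_derive s 1 c (dc s)) ->
  (forall s, s \in `[a, b] -> enorm (dc s) <= L) -> lipschitz_arc a b L c.
Proof.
move=> cd dL.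
have key s r : s < r -> s \in `[a, b] -> r \in `[a, b] ->
    enorm (c r - c s) <= L * (r - s).
  move=> sr; rewrite !in_itv/= => /andP[as_ sb] /andP[ar rb].
  set v := c r - c s.
  have sub z : z \in `[s, r] -> z \in `[a, b].
    by rewrite !in_itv/= => /andP[? ?]; apply/andP; split; lra.
  have vd z : z \in `[a, b] ->
      is_derive z 1 (fun y => dot (c y) v) (dot (dc z) v).
    move=> zab; apply: (is_derive_eq (is_derive_dot (cd z zab) (is_derive_cst _ _ _))).
    by rewrite [dot (c z) _]dotC dot0l addr0.
  have [|z zsr e] := MVT_segment (ltW sr)
    (fun z zsr => vd z (sub z (subset_itv_oo_cc zsr))).
    by apply: derivable_within_continuous => z /sub/vd[].
  have {e} : enorm v ^+ 2 <= enorm v * (L * (r - s)).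
    rewrite enorm_sqr {1}/v dotBl e mulrA [enorm v * L]mulrC.
    rewrite ler_wpM2r ?subr_ge0 ?(ltW sr)// (le_trans (dot_le _ _))//.
    by rewrite ler_wpM2r ?enorm_ge0// dL// sub.
  have [->|v0] := pselect (v = 0).
    rewrite enorm0 => _; rewrite mulr_ge0 ?subr_ge0 ?(ltW sr)//.
    by rewrite (le_trans (enorm_ge0 (dc z)))// dL// sub.
  by rewrite expr2 ler_pM2l// enorm_gt0.
move=> s r sab rab; have [sr|rs|->] := ltgtP s r.
- by rewrite enormBC distrC gtr0_norm ?subr_gt0// key.
- by rewrite gtr0_norm ?subr_gt0// key.
- by rewrite !subrr normr0 mulr0 enorm0.
Qed.

(** A short arc is almost a segment: its Hausdorff measure is squeezed between
the length of the chord and the largest speed times the duration. *)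
Lemma H1_arc_near (s r e : R) c dc (d0 : R * R) : s < r ->
  (forall z, z \in `[s, r] -> is_derive z 1 c (dc z)) ->
  (forall z, z \in `[s, r] -> enorm (dc z - d0) <= e) ->
  `|fine (H1 R (c @` `[s, r])) - enorm d0 * (r - s)| <= e * (r - s).
Proof.
move=> sr cd de.
have rs0 : 0 < r - s by rewrite subr_gt0.
have e0 : 0 <= e.
  by apply: le_trans (de s _); rewrite ?enorm_ge0// in_itv/= lexx ltW.
have cL : lipschitz_arc s r (enorm d0 + e) c.
  apply: derive_lipschitz_arc cd _ => z /de dz.
  rewrite -(subrK d0 (dc z)) addrC (le_trans (enormD _ _))//.
  by rewrite lerD2l.
have up := H1_arc_le (ltW sr) (addr_ge0 (enorm_ge0 d0) e0) cL.
have lo := H1_arc_ge (ltW sr) (lipschitz_arc_continuous cL).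
have fin : H1 R (c @` `[s, r]) \is a fin_num.
  by rewrite ge0_fin_numE ?measure_ge0// (le_lt_trans up)// ltry.
rewrite -(fineK fin) lee_fin in up; rewrite -(fineK fin) lee_fin in lo.
move: up lo; set m := fine _ => up lo.
suff : enorm d0 * (r - s) - e * (r - s) <= m by rewrite ler_norml; lra.
apply: le_trans lo.
have [->|d00] := pselect (d0 = 0).
  by rewrite enorm0 mul0r add0r (le_trans _ (enorm_ge0 _))// oppr_le0 mulr_ge0// ltW.
rewrite -(ler_pM2l (enorm_gt0 d00)) mulrC.
apply: le_trans (_ : dot (c r - c s) d0 <= _); last first.
  by rewrite [leRHS]mulrC dot_le.
have vd z : z \in `[s, r] ->
    is_derive z 1 (fun y => dot (c y) d0) (dot (dc z) d0).
  move=> zsr.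
  apply: (is_derive_eq (is_derive_dot (cd z zsr) (is_derive_cst _ _ _))).
  by rewrite [dot (c z) _]dotC dot0l addr0.
have [|z zsr] := MVT_segment (ltW sr)
    (fun z zsr => vd z (subset_itv_oo_cc zsr)).
  by apply: derivable_within_continuous => z /vd[].
rewrite dotBl => ->; rewrite -mulrBl mulrAC ler_wpM2r ?(ltW rs0)//.
rewrite -(subrK d0 (dc z)) dotDl -enorm_sqr expr2 mulrBl addrC lerD2r.
have := norm_dot_le (dc z - d0) d0; rewrite ler_norml => /andP[+ _].
apply: le_trans; rewrite lerN2 ler_wpM2r ?enorm_ge0// de//.
Qed.

End arcs_smooth.

(** * Line integrals *)

Section negligible.
Variable R : realType.
Context d (T : measurableType d) (mu : {measure set T -> \bar R}).

Lemma Rintegral_setD_null (D N : set T) (f : T -> R) :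
  measurable N -> measurable D -> mu.-integrable D (EFin \o f) ->
  mu N = 0%E -> \int[mu]_(x in D) f x = \int[mu]_(x in D `\` N) f x.
Proof.
by move=> mN mD intf N0; congr fine; exact: (negligible_integral mN).
Qed.

Lemma Rintegral_near_cst (D : set T) (f : T -> R) (k e : R) :
  measurable D -> (mu D < +oo)%E -> mu.-integrable D (EFin \o f) ->
  (forall x, D x -> `|f x - k| <= e) ->
  `|\int[mu]_(x in D) f x - k * fine (mu D)| <= e * fine (mu D).
Proof.
move=> mD Doo intf fk.
have intc r : mu.-integrable D (EFin \o (fun=> r)).
  apply: measurable_bounded_integrable => //.
  by exists `|r|; split; rewrite ?num_real// => M rM x _ /=; exact: ltW.
rewrite -!(Rintegral_cst _ mD) -RintegralB//.
have intfk : mu.-integrable D (EFin \o (fun x => f x - k)).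
  exact: (integrableB mD intf (intc k)).
rewrite (le_trans (le_normr_Rintegral _ _))//.
apply: le_Rintegral => //.
exact: (integrable_abse intfk).
Qed.

End negligible.

Section line_integral.
Variables (R : realType) (c dc : R -> R * R).
Implicit Types s r z a b : R.
Hypothesis cd : forall s, s \in `[0, 1] -> is_derive s 1 c (dc s).
Hypothesis dcc : forall s, s \in `[0, 1] -> {for s, continuous dc}.
Hypothesis cinj : {in `[0, 1] &, injective c}.

Let T := caratheodory_type (hausdorff1_outer R).
(* Open arcs, because the integrand below is known only for parameters in ]0, 1[;
   their endpoints are null. *)
Let E (s r : R) : set T := c @` `]s, r[.
Let mu := H1 R.

Let itv01 (s r z : R) : 0 <= s -> r <= 1 -> z \in `[s, r] -> z \in `[0, 1].
Proof. by move=> s0 r1; rewrite !in_itv/= => /andP[? ?]; apply/andP; split; lra. Qed.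

Lemma speed_continuous s : s \in `[0, 1] -> {for s, continuous (fun z => enorm (dc z))}.
Proof.
move=> s01; apply: (@continuous_comp _ _ _ dc (@enorm R)); first exact: dcc.
exact: enorm_continuous.
Qed.

Lemma for_within_continuous (U : topologicalType) (f : R -> U) (a b : R) :
  (forall s, s \in `[a, b] -> {for s, continuous f}) ->
  {within `[a, b], continuous f}.
Proof.
move=> fc; apply/subspace_continuousP => s sab.
by apply: cvg_within_filter; exact: fc.
Qed.

Lemma arc_speed_bound : exists2 L, 0 <= L & lipschitz_arc 0 1 L c.
Proof.
have [|m m01 mmax] := @EVT_max R (fun z => enorm (dc z)) 0 1 ler01.
  exact: for_within_continuous speed_continuous.
exists (enorm (dc m)); first exact: enorm_ge0.
exact: derive_lipschitz_arc cd mmax.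
Qed.

Let sub_lipschitz L s r : 0 <= s -> r <= 1 ->
  lipschitz_arc 0 1 L c -> lipschitz_arc s r L c.
Proof. by move=> s0 r1 cL x y xsr ysr; apply: cL; exact: (itv01 s0 r1). Qed.

Let open_arcE s r : 0 <= s -> s <= r -> r <= 1 ->
  E s r = c @` `[s, r] `\` [set c s; c r].
Proof.
move=> s0 sr r1.
have ssr : s \in `[s, r] by rewrite in_itv/= lexx.
have rsr : r \in `[s, r] by rewrite in_itv/= lexx sr.
apply/seteqP; split => [_ [z /= zsr <-]|_ [[z /= zsr <-] zN]].
  have zsr' : z \in `[s, r] by exact: subset_itv_oo_cc.
  split; first by exists z.
  have z01 : z \in `[0, 1] := itv01 s0 r1 zsr'.
  case=> /cinj ze; move: zsr; rewrite ze// ?in_itv/= ?ltxx ?andbF//.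
    by rewrite s0 (le_trans sr).
  by rewrite r1 (le_trans s0).
exists z => //=; rewrite in_itv/= !lt_neqAle.
move: (zsr); rewrite in_itv/= => /andP[-> ->]; rewrite !andbT.
by apply/andP; split; apply/eqP => ze; apply: zN; [left|right]; rewrite ze.
Qed.

Let mE s r : 0 <= s -> s <= r -> r <= 1 -> measurable (E s r).
Proof.
move=> s0 sr r1; rewrite open_arcE//; have [L _ cL] := arc_speed_bound.
apply: measurableD.
  exact: (arc_measurable_H1 (sub_lipschitz s0 r1 cL)).
by apply: measurableU; exact: measurable_point.
Qed.

Let mu_pair x y : mu [set x; y] = 0%E.
Proof.
apply/eqP; rewrite eq_le measure_ge0 andbT.
by rewrite (le_trans (outer_measureU2 (hausdorff1_outer R) _ _))// !H1_point adde0.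
Qed.

Let mu_open_arc s r : 0 <= s -> s <= r -> r <= 1 ->
  mu (E s r) = mu (c @` `[s, r]).
Proof.
move=> s0 sr r1; apply/eqP; rewrite eq_le; apply/andP; split.
  by apply: (le_outer_measure (hausdorff1_outer R)); rewrite open_arcE// => x [].
apply: (@le_trans _ _ (mu (E s r) + mu [set c s; c r])%E).
  apply: le_trans (outer_measureU2 (hausdorff1_outer R) _ _).
  apply: (le_outer_measure (hausdorff1_outer R)) => x cx.
  rewrite open_arcE//.
  by have [?|?] := pselect ([set c s; c r] x); [right|left].
by rewrite mu_pair adde0.
Qed.

Let mu_open_arc_fin s r : 0 <= s -> s <= r -> r <= 1 -> (mu (E s r) < +oo)%E.
Proof.
move=> s0 sr r1; rewrite mu_open_arc//; have [L L0 cL] := arc_speed_bound.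
by rewrite (le_lt_trans (H1_arc_le sr L0 (sub_lipschitz s0 r1 cL)))// ltry.
Qed.

Variables (g : R * R -> R) (h : R -> R).
Hypothesis gint : mu.-integrable (c @` `[0, 1]) (EFin \o g).
Hypothesis hc : forall s, s \in `[0, 1] -> {for s, continuous h}.
Hypothesis gh : forall s, s \in `]0, 1[ -> g (c s) = h s.

Let mG : measurable (c @` `[0, 1] : set T).
Proof. by have [L _ cL] := arc_speed_bound; exact: arc_measurable_H1 cL. Qed.

Let gintE s r : 0 <= s -> s <= r -> r <= 1 -> mu.-integrable (E s r) (EFin \o g).
Proof.
move=> s0 sr r1; apply: (integrableS mG) => //; first exact: mE.
by move=> _ [z zsr <-]; exists z => //; apply: (itv01 s0 r1); exact: subset_itv_oo_cc.
Qed.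

Let Phi s := \int[mu]_(x in E 0 s) g x.

Let Phi_incr s r : 0 <= s -> s <= r -> r <= 1 ->
  Phi r - Phi s = \int[mu]_(x in E s r) g x.
Proof.
move=> s0 sr r1; have r0 : 0 <= r by rewrite (le_trans s0).
have s1 : s <= 1 by rewrite (le_trans sr).
rewrite /Phi (Rintegral_setD_null (measurable_point (c s))
  (mE (lexx 0) r0 r1) (gintE (lexx 0) r0 r1) (H1_point (c s))).
have eqE : E 0 r `\` [set c s] = E 0 s `|` E s r.
  apply/seteqP; split => [_ [[z /= z0r <-] zs]|_ [] [z /= zi <-]].
  - have [zlt|zgt|ze] := ltgtP z s.
    + by left; exists z => //=; move: z0r; rewrite !in_itv/= => /andP[-> _].
    + by right; exists z => //=; move: z0r; rewrite !in_itv/= zgt => /andP[_ ->].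
    + by exfalso; apply: zs; rewrite ze.
  - split.
      exists z => //=; move: zi; rewrite !in_itv/= => /andP[-> zs].
      by rewrite (lt_le_trans zs).
    move=> /cinj ze; have : z = s.
      by move: zi; rewrite in_itv/= => /andP[? ?];
        apply: ze; rewrite in_itv/=; apply/andP; split; lra.
    by move: zi => /[swap] ->; rewrite in_itv/= ltxx andbF.
  - split.
      exists z => //=; move: zi; rewrite !in_itv/= => /andP[sz ->].
      by rewrite (le_lt_trans s0).
    move=> /cinj ze; have : z = s.
      by move: zi; rewrite in_itv/= => /andP[? ?];
        apply: ze; rewrite in_itv/=; apply/andP; split; lra.
    by move: zi => /[swap] ->; rewrite in_itv/= ltxx.
rewrite eqE Rintegral_setU; first by rewrite addrAC subrr add0r.
- exact: mE.
- exact: mE.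
- rewrite -eqE; apply: (integrableS (mE (lexx 0) r0 r1)).
  + by apply: measurableD; [exact: mE|exact: measurable_point].
  + by move=> x [].
  + exact: gintE.
- apply/disj_setPS => x [[z /= z1 <-] [y /= y1 yz]].
  have : y = z.
    move: z1 y1; rewrite !in_itv/= => /andP[? ?] /andP[? ?].
    by apply: cinj => //; rewrite in_itv/=; apply/andP; split; lra.
  move=> yE; move: z1 y1; rewrite yE !in_itv/= => /andP[_ zs] /andP[sz _].
  by have := lt_trans zs sz; rewrite ltxx.
Qed.

Let Phi_near s r (k e : R) : 0 <= s -> s <= r -> r <= 1 ->
  (forall z, z \in `]s, r[ -> `|h z - k| <= e) ->
  `|Phi r - Phi s - k * fine (mu (c @` `[s, r]))| <=
    e * fine (mu (c @` `[s, r])).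
Proof.
move=> s0 sr r1 hk; rewrite Phi_incr// -mu_open_arc//.
apply: Rintegral_near_cst; [exact: mE|exact: mu_open_arc_fin|exact: gintE|].
move=> _ [z /= zsr <-]; rewrite gh ?hk//.
by move: zsr; rewrite !in_itv/= => /andP[? ?]; apply/andP; split; lra.
Qed.

(** On a short arc g is almost equal to h s, and the measure of the arc is almost
its duration times the speed. *)
Let Phi_derive s : s \in `]0, 1[ -> is_derive s 1 Phi (h s * enorm (dc s)).
Proof.
move=> s01; have s01' : s \in `[0, 1] by exact: subset_itv_oo_cc.
apply: cvg_is_derive; apply/cvgrPdist_le => e e0.
set D := enorm (dc s); have D0 : 0 <= D := enorm_ge0 _.
(* The error in incr below is at most e1 * K times the duration. *)
pose K := D + 1 + `|h s|; have K0 : 0 < K by rewrite /K; have := normr_ge0 (h s); lra.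
pose e1 := Num.min 1 (e / K).
have e10 : 0 < e1 by rewrite lt_min ltr01 divr_gt0.
have e11 : e1 <= 1 by rewrite ge_min lexx.
have e1K : e1 * K <= e by rewrite -ler_pdivlMr// ge_min lexx orbT.
have : \forall z \near s, [/\ z \in `]0, 1[, `|h z - h s| <= e1 &
    enorm (dc z - dc s) <= e1].
  near=> z; split; near: z; first exact: near_in_itvoo.
    have /cvgrPdist_le/(_ _ e10) := hc s01'.
    by apply: filterS => z; rewrite distrC.
  have : (fun z => enorm (dc z - dc s)) @ s --> enorm (dc s - dc s).
    apply: (@continuous_comp _ _ _ (fun z => dc z - dc s) (@enorm R)).
      by apply: cvgB; [exact: dcc|exact: cvg_cst].
    exact: enorm_continuous.
  rewrite subrr enorm0 => /cvgrPdist_le/(_ _ e10); apply: filterS => z.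
  by rewrite sub0r normrN ger0_norm// enorm_ge0.
move=> /nbhs_ballP[eta /= eta0 near_s].
have incr a b : a < b -> (forall z, z \in `[a, b] -> ball s eta z) ->
    `|Phi b - Phi a - h s * D * (b - a)| <= e * (b - a).
  move=> ab sub.
  have sub' z : z \in `[a, b] -> [/\ z \in `]0, 1[, `|h z - h s| <= e1 &
    enorm (dc z - dc s) <= e1] by move=> /sub/near_s.
  have [a01 _ _] := sub' a ltac:(by rewrite in_itv/= lexx ltW).
  have [b01 _ _] := sub' b ltac:(by rewrite in_itv/= lexx ltW).
  move: a01 b01; rewrite !in_itv/= => /andP[a0 a1] /andP[b0 b1].
  have := @H1_arc_near R a b e1 c dc (dc s) ab.
  move=> /(_ (fun z zab => cd (itv01 (ltW a0) (ltW b1) zab))).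
  move=> /(_ (fun z zab => let: And3 _ _ x := sub' z zab in x)).
  have := @Phi_near a b (h s) e1 (ltW a0) (ltW ab) (ltW b1)
    (fun z zab => let: And3 _ x _ := sub' z (subset_itv_oo_cc zab) in x).
  rewrite -/mu -/D; set m := fine _ => h1 h2.
  have m0 : 0 <= m by rewrite fine_ge0// measure_ge0.
  have mle : m <= (D + e1) * (b - a) by move: h2; rewrite ler_norml; lra.
  rewrite (_ : Phi b - Phi a - _ = (Phi b - Phi a - h s * m) +
    h s * (m - D * (b - a))); last by ring.
  rewrite (le_trans (ler_normD _ _))// normrM.
  apply: (@le_trans _ _ (e1 * K * (b - a))); last first.
    by rewrite ler_wpM2r// subr_ge0 ltW.
  have h3 : `|h s| * `|m - D * (b - a)| <= `|h s| * (e1 * (b - a)).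
    by rewrite ler_wpM2l.
  have h4 : e1 * m <= e1 * ((D + 1) * (b - a)).
    rewrite ler_wpM2l ?(ltW e10)// (le_trans mle)// ler_wpM2r ?subr_ge0 ?(ltW ab)//.
    by rewrite lerD2l.
  by rewrite /K; lra.
near=> x.
have x0 : x != 0 by near: x; exact: nbhs_dnbhs_neq.
have xeta : `|x| < eta by near: x; exact: dnbhs0_lt.
rewrite /GRing.scale /= mulr1.
have [xneg|xpos|] := ltgtP x 0; last by move/eqP; rewrite (negbTE x0).
- have := @incr (x + s) s ltac:(by lra).
  rewrite (_ : s - (x + s) = - x); last by ring.
  move=> Hi; have {Hi} : `|Phi s - Phi (x + s) - h s * D * (- x)| <= e * (- x).
    apply: Hi => z; rewrite in_itv/= /ball/= => /andP[? ?].
    by rewrite ger0_norm; move: xeta; rewrite ltr0_norm//; lra.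
  rewrite (_ : h s * D - _ = (Phi s - Phi (x + s) - h s * D * (- x)) / x); last first.
    by field.
  by rewrite normrM normfV (ltr0_norm xneg) ler_pdivrMr// oppr_gt0.
- have := @incr s (x + s) ltac:(by lra).
  rewrite (_ : (x + s) - s = x); last by ring.
  move=> Hi; have {Hi} : `|Phi (x + s) - Phi s - h s * D * x| <= e * x.
    apply: Hi => z; rewrite in_itv/= /ball/= => /andP[? ?].
    by rewrite ler0_norm; move: xeta; rewrite gtr0_norm//; lra.
  rewrite (_ : h s * D - _ = - (Phi (x + s) - Phi s - h s * D * x) / x); last first.
    by field.
  by rewrite normrM normfV normrN (gtr0_norm xpos) ler_pdivrMr.
Unshelve. all: by end_near. Qed.

Let Phi_lipschitz : exists2 K, 0 <= K &
  forall s r, 0 <= s -> s <= r -> r <= 1 -> `|Phi r - Phi s| <= K * (r - s).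
Proof.
have [L L0 cL] := arc_speed_bound.
have hcw := for_within_continuous hc.
have [|m m01 mmax] := @EVT_max R (fun z => `|h z|) 0 1 ler01.
  apply: for_within_continuous => s s01.
  by apply: (@continuous_comp _ _ _ h Num.norm); [exact: hc|exact: norm_continuous].
exists (`|h m| * L); first by rewrite mulr_ge0.
move=> s r s0 sr r1; have := @Phi_near s r 0 `|h m| s0 sr r1.
rewrite mul0r subr0 => Hi; apply: le_trans (Hi _) _.
  by move=> z zsr; rewrite subr0 mmax// (itv01 s0 r1)// subset_itv_oo_cc.
rewrite -mulrA ler_wpM2l// -lee_fin fineK.
  exact: H1_arc_le sr L0 (sub_lipschitz s0 r1 cL).
by rewrite ge0_fin_numE ?measure_ge0// -mu_open_arc// mu_open_arc_fin.
Qed.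

Let Phi_continuous : {within `[0, 1], continuous Phi}.
Proof.
have [K K0 PhiK] := Phi_lipschitz.
apply/subspace_continuousP => s; rewrite /= in_itv/= => /andP[s0 s1].
have K1 : 0 < K + 1 by rewrite ltr_wpDl.
apply/cvgrPdist_le => e e0; rewrite near_withinE.
near=> r; rewrite /= in_itv/= => /andP[r0 r1].
have sr : `|s - r| <= e / (K + 1).
  near: r; apply: (@cvgr_dist_le _ _ _ (nbhs s) _ id s) => //.
  by rewrite divr_gt0.
apply: (@le_trans _ _ (K * `|s - r|)); last first.
  rewrite (le_trans (ler_wpM2l K0 sr))// mulrCA ler_piMr ?(ltW e0)//.
  by rewrite ler_pdivrMr// mul1r; lra.
have [lesr|ltrs] := leP s r.
  by rewrite distrC [`|s - r|]distrC [`|r - s|]ger0_norm ?subr_ge0// PhiK.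
by rewrite [`|s - r|]gtr0_norm ?subr_gt0// PhiK// ltW.
Unshelve. all: by end_near. Qed.

(** As functions of the endpoint of the arc, both sides have derivative h times
speed and vanish for the empty arc. *)
Lemma line_integral :
  \int[H1 R]_(x in c @` `[0, 1]) g x =
  \int[lebesgue_measure]_(s in `[0, 1]) (h s * enorm (dc s)).
Proof.
pose k s := h s * enorm (dc s).
have kc s : s \in `[0, 1] -> {for s, continuous k}.
  by move=> s01; apply: cvgM; [exact: hc|exact: speed_continuous].
have kcw := for_within_continuous kc.
have kint : lebesgue_measure.-integrable `[0, 1] (EFin \o k).
  by apply: continuous_compact_integrable => //; exact: segment_compact.
pose Psi s := \int[lebesgue_measure]_(z in `[0, s]) k z.
have Psi_derive s : s \in `]0, 1[ -> is_derive s 1 Psi (k s).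
  move=> s01; have s01' : s \in `[0, 1] by exact: subset_itv_oo_cc.
  move: s01; rewrite in_itv/= => /andP[s0 s1].
  have [Pd Pe] := @continuous_FTC1 R k (BLeft 0) s 1 s1 kint s0 (kc s s01').
  exact: DeriveDef Pd (etrans (esym (derive1E _ _)) Pe).
have fd s : s \in `]0, 1[ -> is_derive s 1 (Phi - Psi) 0.
  move=> s01.
  by apply: (is_derive_eq (is_deriveB (Phi_derive s01) (Psi_derive s s01))); rewrite subrr.
have [|z z01] := MVT_segment ler01 fd.
  apply: within_continuousB; first exact: Phi_continuous.
  exact: parameterized_integral_continuous.
rewrite mul0r => /eqP; rewrite subr_eq0 => /eqP.
rewrite -[(Phi - Psi) 1]/(Phi 1 - Psi 1) -[(Phi - Psi) 0]/(Phi 0 - Psi 0).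
have -> : Phi 0 = 0.
  rewrite /Phi /E (_ : [set` `]0, 0[] = set0) ?image_set0 ?Rintegral_set0//.
  by apply/seteqP; split => x //=; rewrite in_itv/=; lra.
have -> : Psi 0 = 0.
  rewrite /Psi (_ : [set` `[0, 0]] = [set 0]) ?Rintegral_set1//.
  by rewrite set_itv1.
rewrite subrr => /eqP; rewrite subr_eq0 => /eqP.
rewrite /Psi /k => <-; rewrite /Phi open_arcE//.
apply: Rintegral_setD_null => //.
  by apply: measurableU; exact: measurable_point.
Qed.

End line_integral.

Section arc_length.
Variables (R : realType) (c dc : R -> R * R).
Hypothesis cd : forall s : R, s \in `[0, 1] -> is_derive s 1 c (dc s).
Hypothesis dcc : forall s : R, s \in `[0, 1] -> {for s, continuous dc}.
Hypothesis cinj : {in `[0, 1] &, injective c}.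

Lemma arc_length :
  \int[H1 R]_(x in c @` `[0, 1]) 1 =
  \int[lebesgue_measure]_(s in `[0, 1]) enorm (dc s).
Proof.
have [L L0 cL] := arc_speed_bound cd dcc.
rewrite (@line_integral R c dc cd dcc cinj _ (fun=> 1)).
- by apply: eq_Rintegral => s _; rewrite mul1r.
- apply: measurable_bounded_integrable.
  + exact: arc_measurable_H1 cL.
  + by rewrite (le_lt_trans (H1_arc_le ler01 L0 cL))// ltry.
  + exact: measurable_cst.
  + by exists 1; split; rewrite ?num_real// => M M1 x _ /=; rewrite normr1 ltW.
- by move=> s _; exact: cvg_cst.
- by [].
Qed.

End arc_length.

(** * Differentiation with respect to a parameter *)

Section slices.
Variables (R : realType) (W : normedModType R).
Implicit Types (f : R * R -> W) (t s : R) (l : W).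

Lemma slice1E f t s l :
  is_derive (t, s) e1 f l <-> is_derive t 1 (fun z => f (z, s)) l.
Proof.
have eqf h : h *: e1 + (t, s) = (h *: (1 : R) + t, s) :> R * R.
  rewrite [LHS]surjective_pairing /=.
  by congr (_, _); rewrite /GRing.scale /= mulr0 add0r.
split => /is_derive_cvg fl; apply: cvg_is_derive; apply: cvg_trans fl;
  by apply: near_eq_cvg; apply: nearW => h; rewrite eqf.
Qed.

Lemma slice2E f t s l :
  is_derive (t, s) e2 f l <-> is_derive s 1 (fun z => f (t, z)) l.
Proof.
have eqf h : h *: e2 + (t, s) = (t, h *: (1 : R) + s) :> R * R.
  rewrite [LHS]surjective_pairing /=.
  by congr (_, _); rewrite /GRing.scale /= mulr0 add0r.
split => /is_derive_cvg fl; apply: cvg_is_derive; apply: cvg_trans fl;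
  by apply: near_eq_cvg; apply: nearW => h; rewrite eqf.
Qed.

Lemma slice2_continuous f t s :
  {for (t, s), continuous f} -> {for s, continuous (fun z => f (t, z))}.
Proof.
move=> fc; apply: (@continuous_comp _ _ _ (fun z => (t, z)) f) => //.
exact: (cvg_pair (@cvg_cst _ t _ (nbhs s) _) (@cvg_id _ (nbhs s))).
Qed.

End slices.

Section derive_within.
Variable R : realType.
Implicit Types (f g : R -> R) (t T l : R).

Lemma is_derive_is_derive_within (I : set R) f t l :
  is_derive t 1 f l -> is_derive_within I f t l.
Proof.
move=> /is_derive_cvg fl; apply/cvgrPdist_le => e e0.
move/cvgrPdist_le : fl => /(_ _ e0); rewrite !near_withinE.
move=> /nbhs_ballP[d /= d0 fd].
near=> s => -[_ st].
have := fd (s - t); rewrite /= subr_eq0 => /(_ _ (introN eqP st)).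
rewrite /GRing.scale /= mulr1 subrK mulrC; apply.
rewrite /ball/= sub0r normrN distrC; near: s.
by apply: (@cvgr_dist_lt _ _ _ (nbhs t) _ id t).
Unshelve. all: by end_near. Qed.

Lemma within_itv_proper T t : 0 < T -> t \in `[0, T] ->
  ProperFilter (within (`[0, T]%classic `\ t) (nbhs t)).
Proof.
move=> T0; rewrite in_itv/= => /andP[t0 tT]; apply: within_nbhs_proper.
move=> B /nbhs_ballP[e /= e0 eB].
have [tlt|tge] := ltP t T.
- pose s := Num.min (t + e / 2) T; exists s; split.
    split; last first.
      by apply/eqP; rewrite gt_eqF// /s lt_min tlt ltrDl divr_gt0.
    by rewrite /= in_itv/= /s le_min ge_min lexx orbT; lra.
  apply: eB; rewrite /ball/= ltr0_norm ?subr_lt0.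
    have : s <= t + e / 2 by rewrite ge_min lexx.
    by lra.
  by rewrite /s lt_min tlt ltrDl divr_gt0.
- pose s := Num.max (t - e / 2) 0; exists s; split.
    split; last first.
      by apply/eqP; rewrite lt_eqF// /s gt_max gtrBl divr_gt0//; lra.
    by rewrite /= in_itv/= /s le_max ge_max lexx orbT; lra.
  apply: eB; rewrite /ball/= gtr0_norm ?subr_gt0.
    have : t - e / 2 <= s by rewrite le_max lexx.
    by lra.
  by rewrite /s gt_max gtrBl divr_gt0//; lra.
Qed.

Lemma is_derive_within_unique T f t l l' : 0 < T -> t \in `[0, T] ->
  is_derive_within `[0, T] f t l -> is_derive_within `[0, T] f t l' -> l = l'.
Proof.
move=> T0 tT fl fl'; have ? := within_itv_proper T0 tT.
exact: (cvg_unique _ fl fl').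
Qed.

Lemma eq_is_derive_within (I : set R) f g t l : I t ->
  (forall s, I s -> f s = g s) ->
  is_derive_within I f t l -> is_derive_within I g t l.
Proof.
move=> It fg; apply: cvg_trans; apply: near_eq_cvg; rewrite near_withinE.
by apply: nearW => s [Is _]; rewrite !fg.
Qed.

Lemma cvg_sumr (I X : Type) (F : set_system X) {FF : Filter F} (r : seq I)
    (u : I -> X -> R) (l : I -> R) :
  (forall i, u i x @[x --> F] --> l i) ->
  \sum_(i <- r) u i x @[x --> F] --> \sum_(i <- r) l i.
Proof.
move=> ul; elim: r => [|i r ih].
  by under eq_fun do rewrite big_nil; rewrite big_nil; exact: cvg_cst.
by under eq_fun do rewrite big_cons; rewrite big_cons; exact: cvgD (ul i) ih.
Qed.

Lemma is_derive_within_sum (I : set R) n (k : 'I_n -> R) (f : 'I_n -> R -> R)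
    (l : 'I_n -> R) t :
  (forall i, is_derive_within I (f i) t (l i)) ->
  is_derive_within I (fun s => \sum_(i < n) k i * f i s) t
    (\sum_(i < n) k i * l i).
Proof.
move=> fl; rewrite /is_derive_within.
under eq_fun do [rewrite -sumrB mulr_suml;
  under eq_bigr do rewrite -mulrBr -mulrA].
by apply: cvg_sumr => i; apply: cvgM; [exact: cvg_cst|exact: fl].
Qed.

Lemma mean_value T g dg t r : t \in `[0, T] -> r \in `[0, T] ->
  (forall z, z \in `[0, T] -> is_derive z 1 g (dg z)) ->
  exists z, [/\ z \in `[0, T], `|z - t| <= `|r - t| &
    g r - g t = dg z * (r - t)].
Proof.
rewrite !in_itv/= => /andP[t0 tT] /andP[r0 rT] gd.
have [tr|rt|->] := ltgtP t r; last first.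
- by exists r; rewrite !subrr mulr0 lexx in_itv/= r0 rT.
- have sub z : z \in `[r, t] -> z \in `[0, T].
    by rewrite !in_itv/= => /andP[? ?]; apply/andP; split; lra.
  have [|z zrt e] := MVT_segment (ltW rt)
    (fun z zrt => gd z (sub z (subset_itv_oo_cc zrt))).
    by apply: derivable_within_continuous => z /sub/gd[].
  exists z; split; [exact: sub| |by rewrite -opprB e -mulrN opprB].
  move: zrt; rewrite in_itv/= => /andP[? ?].
  by rewrite !ler0_norm; lra.
- have sub z : z \in `[t, r] -> z \in `[0, T].
    by rewrite !in_itv/= => /andP[? ?]; apply/andP; split; lra.
  have [|z zrt e] := MVT_segment (ltW tr)
    (fun z zrt => gd z (sub z (subset_itv_oo_cc zrt))).
    by apply: derivable_within_continuous => z /sub/gd[].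
  exists z; split; [exact: sub| |exact: e].
  move: zrt; rewrite in_itv/= => /andP[? ?].
  by rewrite !ger0_norm; lra.
Qed.

End derive_within.

Section under_integral.
Variables (R : realType) (T a b : R) (f df : R * R -> R).
Hypothesis ab : a <= b.
Hypothesis fd : forall t s : R, t \in `[0, T] -> s \in `[a, b] ->
  is_derive (t, s) e1 f (df (t, s)).
Hypothesis dfc : forall t s : R, t \in `[0, T] -> s \in `[a, b] ->
  {for (t, s), continuous df}.
Hypothesis fc : forall t s : R, t \in `[0, T] -> s \in `[a, b] ->
  {for s, continuous (fun z => f (t, z))}.

Lemma itv_integrable (u : R -> R) :
  (forall s : R, s \in `[a, b] -> {for s, continuous u}) ->
  lebesgue_measure.-integrable `[a, b] (EFin \o u).
Proof.
move=> uc; apply: continuous_compact_integrable; first exact: segment_compact.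
exact: for_within_continuous uc.
Qed.

(** By the mean value theorem a difference quotient in t is a value of df at a
nearby time.  It is close to the value at time t, uniformly in s because [a, b]
is compact. *)
Lemma derive_within_under_integral (t : R) : t \in `[0, T] ->
  is_derive_within `[0, T]
    (fun r => \int[lebesgue_measure]_(s in `[a, b]) f (r, s)) t
    (\int[lebesgue_measure]_(s in `[a, b]) df (t, s)).
Proof.
move=> tT; apply/cvgrPdist_le => e e0; rewrite near_withinE.
have ba0 : 0 < b - a + 1 by rewrite ltr_wpDl ?subr_ge0.
pose e' := e / (b - a + 1); have e'0 : 0 < e' by rewrite divr_gt0.
have unif : \forall r \near t, forall s, s \in `[a, b] ->
    `|df (r, s) - df (t, s)| <= e'.
  have /compact_near_coveringP := @segment_compact R a b.
  move=> /(_ R (nbhs t) (fun r s => `|df (r, s) - df (t, s)| <= e') _).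
  apply=> s /= sab.
  have e'2 : 0 < e' / 2 by rewrite divr_gt0.
  have /cvgrPdist_le/(_ _ e'2)/nbhs_ballP[d /= d0 dP] := dfc tT sab.
  near=> z r => /=.
  have zd : ball s d z by near: z; exact: nbhsx_ballx.
  have rd : ball t d r by near: r; exact: nbhsx_ballx.
  rewrite [e']splitr -[df _ - _](subrKA (df (t, s))).
  rewrite (le_trans (ler_normD _ _))// lerD//.
    by rewrite distrC; apply: dP.
  by apply: dP; split => //; exact: ballxx.
near=> r => -[/= rT /eqP rt].
have unifr : forall q : R, `|q - t| <= `|r - t| -> forall s, s \in `[a, b] ->
    `|df (q, s) - df (t, s)| <= e'.
  near: r; move: unif => /nbhs_ballP[d /= d0 dP]; near=> r => q qr; apply: dP.
  rewrite /ball/= distrC (le_lt_trans qr)// distrC; near: r.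
have intf q : q \in `[0, T] ->
    lebesgue_measure.-integrable `[a, b] (EFin \o (fun s => f (q, s))).
  by move=> qT; apply: itv_integrable => s; exact: fc.
have dftc s : s \in `[a, b] -> {for s, continuous (fun z => df (t, z))}.
  by move=> sab; apply: slice2_continuous; exact: dfc.
have intdf : lebesgue_measure.-integrable `[a, b] (EFin \o (fun s => df (t, s))).
  exact: itv_integrable.
pose u s := f (r, s) - f (t, s) - (r - t) * df (t, s).
have uc s : s \in `[a, b] -> {for s, continuous u}.
  move=> sab; apply: cvgB; first by apply: cvgB; exact: fc.
  by apply: cvgM; [exact: cvg_cst|exact: dftc].
have mab : lebesgue_measure (`[a, b] : set R) = (b - a)%:E.
  rewrite lebesgue_measure_itv/= lte_fin; case: ltP => // ba.
  by rewrite (@le_anti _ _ a b) ?subrr// ab.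
have ub : `|\int[lebesgue_measure]_(s in `[a, b]) u s| <= e' * `|r - t| * (b - a).
  have uK s : `[a, b]%classic s -> `|u s - 0| <= e' * `|r - t|.
    move=> /= sab; rewrite subr0.
    have [z [zT zr e1]] := mean_value tT rT
      (fun z zT => (slice1E f z s (df (z, s))).1 (fd zT sab)).
    by rewrite /u e1 [_ * (r - t)]mulrC -mulrBr normrM mulrC ler_wpM2r// unifr.
  have foo : (lebesgue_measure (`[a, b]%classic : set R) < +oo)%E.
    by rewrite mab ltry.
  have := @Rintegral_near_cst R _ _ (@lebesgue_measure R) `[a, b]%classic u 0
    (e' * `|r - t|) (measurable_itv _) foo (itv_integrable uc) uK.
  by rewrite mul0r subr0; congr (_ <= _ * _); exact: (congr1 fine mab).
have uE : \int[lebesgue_measure]_(s in `[a, b]) u s =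
    \int[lebesgue_measure]_(s in `[a, b]) f (r, s) -
    \int[lebesgue_measure]_(s in `[a, b]) f (t, s) -
    (r - t) * \int[lebesgue_measure]_(s in `[a, b]) df (t, s).
  have mI : measurable (`[a, b] : set R) by exact: measurable_itv.
  rewrite /u RintegralB//; last 2 first.
  - by apply: itv_integrable => s sab; apply: cvgB; exact: fc.
  - apply: itv_integrable => s sab.
    by apply: cvgM; [exact: cvg_cst|exact: dftc].
  by rewrite RintegralB ?intf// RintegralZl.
have rt0 : r - t != 0 by rewrite subr_eq0.
set I1 := Rintegral _ _ _; set I2 := Rintegral _ _ _; set I3 := Rintegral _ _ _.
rewrite (_ : I1 - _ = - (I2 - I3 - (r - t) * I1) / (r - t)); last by field.
rewrite -uE normrM normfV normrN ler_pdivrMr ?normr_gt0//.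
rewrite (le_trans ub)// mulrAC ler_wpM2r// /e' -mulrA ler_piMr ?(ltW e0)//.
by rewrite mulrC ler_pdivrMr// mul1r lerDl.
Unshelve. all: by end_near. Qed.

End under_integral.

Section mixed_derivatives.
Variable R : realType.

Lemma Rintegral_derive (a b : R) (F f : R -> R) : a < b ->
  (forall s : R, s \in `]a, b[ -> is_derive s 1 F (f s)) ->
  {within `[a, b], continuous F} -> {within `[a, b], continuous f} ->
  \int[lebesgue_measure]_(s in `[a, b]) f s = F b - F a.
Proof.
move=> ab Fd Fc fc; rewrite /Rintegral (continuous_FTC2 ab fc (F := F)) //.
- have [_ Fa Fb] := (continuous_within_itvP _ ab).1 Fc.
  by split => // s sab; have [] := Fd s sab.
- by move=> s sab; rewrite derive1E; have [] := Fd s sab.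
Qed.

Variables (T : R) (f f1 f2 f12 : R * R -> R).
Hypothesis T0 : 0 < T.
Hypothesis fd1 : forall t s : R, t \in `[0, T] -> s \in `[0, 1] ->
  is_derive (t, s) e1 f (f1 (t, s)).
Hypothesis fd2 : forall t s : R, t \in `[0, T] -> s \in `[0, 1] ->
  is_derive (t, s) e2 f (f2 (t, s)).
Hypothesis fd12 : forall t s : R, t \in `[0, T] -> s \in `[0, 1] ->
  is_derive (t, s) e1 f2 (f12 (t, s)).
Hypothesis f2c : forall t s : R, t \in `[0, T] -> s \in `[0, 1] ->
  {for (t, s), continuous f2}.
Hypothesis f12c : forall t s : R, t \in `[0, T] -> s \in `[0, 1] ->
  {for (t, s), continuous f12}.

(** The existence of the mixed derivative in the other order has to be shown as
well.  Differentiation in t of f(t, s) - f(t, 0), which is the integral of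
f2(t, .) over [0, s], gives f1(t, s) - f1(t, 0) as the integral of f12(t, .). *)
Lemma mixed_derivative (t s : R) : t \in `[0, T] -> s \in `]0, 1[ ->
  is_derive s 1 (fun z => f1 (t, z)) (f12 (t, s)).
Proof.
move=> tT; rewrite in_itv/= => /andP[s0 s1].
have s01 (z : R) : z \in `]0, 1[ -> z \in `[0, 1] by exact: subset_itv_oo_cc.
have incr (z : R) : z \in `]0, 1[ ->
    f1 (t, z) = f1 (t, 0) + \int[lebesgue_measure]_(y in `[0, z]) f12 (t, y).
  move=> z01; move: (z01); rewrite in_itv/= => /andP[z0 z1].
  have z01' := s01 z z01.
  have sub (y : R) : y \in `[0, z] -> y \in `[0, 1].
    by rewrite !in_itv/= => /andP[? ?]; apply/andP; split; lra.
  have o01 : 0 \in `[0, 1 : R] by rewrite in_itv/= lexx ler01.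
  have l1 : is_derive_within `[0, T]
      (fun r => \int[lebesgue_measure]_(y in `[0, z]) f2 (r, y)) t
      (\int[lebesgue_measure]_(y in `[0, z]) f12 (t, y)).
    apply: (@derive_within_under_integral R T 0 z f2 f12 (ltW z0)
      (fun r y rT y0z => fd12 rT (sub y y0z))) => //.
    - by move=> r y rT /sub; exact: f12c.
    - by move=> r y rT /sub y01; apply: slice2_continuous; exact: f2c.
  have l2 : is_derive_within `[0, T] (fun r => f (r, z) - f (r, 0)) t
      (f1 (t, z) - f1 (t, 0)).
    apply: is_derive_is_derive_within.
    exact: (is_deriveB ((slice1E f t z _).1 (fd1 tT z01'))
      ((slice1E f t 0 _).1 (fd1 tT o01))).
  have l3 : is_derive_within `[0, T] (fun r => f (r, z) - f (r, 0)) t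
      (\int[lebesgue_measure]_(y in `[0, z]) f12 (t, y)).
    apply: eq_is_derive_within l1 => // r /= rT.
    have dz (y : R) : y \in `[0, z] -> is_derive y 1 (fun y => f (r, y)) (f2 (r, y)).
      by move=> /sub y01; apply/slice2E; exact: fd2.
    apply: (Rintegral_derive z0 (F := fun y => f (r, y))
      (fun y y0z => dz y (subset_itv_oo_cc y0z))).
    - by apply: derivable_within_continuous => y /dz[].
    - by apply: for_within_continuous => y /sub y01;
        apply: slice2_continuous; exact: f2c.
  by rewrite -(is_derive_within_unique T0 tT l2 l3) addrC subrK.
have cf12 (y : R) : y \in `[0, 1] -> {for y, continuous (fun y => f12 (t, y))}.
  by move=> y01; apply: slice2_continuous; exact: f12c.
have kint : lebesgue_measure.-integrable `[0, 1] (EFin \o (fun y => f12 (t, y))).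
  exact: itv_integrable.
have [Pd Pe] := @continuous_FTC1 R (fun y => f12 (t, y)) (BLeft 0) s 1 s1 kint s0
  (cf12 s ltac:(by rewrite in_itv/= !ltW)).
have Pd' : is_derive s 1
    (fun z => \int[lebesgue_measure]_(y in `[0, z]) f12 (t, y)) (f12 (t, s)).
  exact: DeriveDef Pd (etrans (esym (derive1E _ _)) Pe).
have := is_deriveD (is_derive_cst (f1 (t, 0)) s 1) Pd'; rewrite add0r.
apply: near_eq_is_derive; near=> z; rewrite incr//.
by near: z; apply: near_in_itvoo; rewrite in_itv/= s0.
Unshelve. all: by end_near. Qed.

End mixed_derivatives.

(** * First variation of length *)

Section speed.
Variables (R : realType) (u : R -> R * R) (du : R * R) (s : R).
Hypothesis ud : is_derive s 1 u du.
Hypothesis u0 : u s <> 0.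

Lemma is_derive_enorm :
  is_derive s 1 (fun z => enorm (u z)) (dot ((enorm (u s))^-1 *: u s) du).
Proof.
have pos : 0 < dot (u s) (u s) by rewrite -enorm_sqr exprn_gt0 ?enorm_gt0.
have ed := @is_derive1_comp R Num.sqrt (fun z => dot (u z) (u z)) s _ _
  (is_derive1_sqrt pos) (is_derive_dot ud ud).
apply: (is_derive_eq ed).
rewrite -/(enorm (u s)) dotZl [dot du _]dotC invfM; have := enorm_gt0 u0.
by move=> /lt0r_neq0 ?; field.
Qed.

(** The derivative of the direction u / |u|. *)
Definition derive_unit : R * R :=
  (enorm (u s))^-1 *: du -
  ((enorm (u s))^-1 ^+ 2 * dot ((enorm (u s))^-1 *: u s) du) *: u s.

Lemma is_derive_unit :
  is_derive s 1 (fun z => (enorm (u z))^-1 *: u z) derive_unit.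
Proof.
have n0 : enorm (u s) != 0 := lt0r_neq0 (enorm_gt0 u0).
have nd := @is_deriveV R (fun z => enorm (u z)) s _ 1 n0 is_derive_enorm.
apply: (is_derive_eq (is_derive_scale nd ud)).
by rewrite addrC /derive_unit -scaleNr /GRing.scale /= -exprVn mulNr.
Qed.

(** The direction u / |u| has constant length. *)
Lemma derive_unit_orthogonal : dot derive_unit (u s) = 0.
Proof.
rewrite /derive_unit dotBl !dotZl -enorm_sqr [dot du _]dotC.
by have := lt0r_neq0 (enorm_gt0 u0) => ?; field.
Qed.

End speed.

Section continuity.
Variables (R : realType) (X : Type) (F : set_system X).
Context {FF : Filter F}.
Implicit Types (u v : X -> R * R) (a b : R * R).

Lemma cvg_fst_comp u a : u x @[x --> F] --> a -> (u x).1 @[x --> F] --> a.1.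
Proof.
by move=> ua; exact: (cvg_comp _ fst ua (@cvg_fst _ _ (nbhs a.1) (nbhs a.2) _)).
Qed.

Lemma cvg_snd_comp u a : u x @[x --> F] --> a -> (u x).2 @[x --> F] --> a.2.
Proof.
by move=> ua; exact: (cvg_comp _ snd ua (@cvg_snd _ _ (nbhs a.1) (nbhs a.2) _)).
Qed.

Lemma cvg_dot u v a b : u x @[x --> F] --> a -> v x @[x --> F] --> b ->
  dot (u x) (v x) @[x --> F] --> dot a b.
Proof.
move=> ua vb; apply: cvgD; apply: cvgM;
  by [exact: cvg_fst_comp|exact: cvg_snd_comp].
Qed.

Lemma cvg_enorm u a : u x @[x --> F] --> a ->
  enorm (u x) @[x --> F] --> enorm a.
Proof. by move=> ua; exact: (cvg_comp _ _ ua (@enorm_continuous R a)). Qed.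

Lemma cvg_enormV u a : a <> 0 -> u x @[x --> F] --> a ->
  (enorm (u x))^-1 @[x --> F] --> (enorm a)^-1.
Proof.
by move=> a0 ua; apply: cvgV; [exact: lt0r_neq0 (enorm_gt0 a0)|exact: cvg_enorm].
Qed.

Lemma cvg_unit u a : a <> 0 -> u x @[x --> F] --> a ->
  (enorm (u x))^-1 *: u x @[x --> F] --> (enorm a)^-1 *: a.
Proof. by move=> a0 ua; apply: cvgZ => //; exact: cvg_enormV. Qed.

End continuity.

Section first_variation.
Variables (R : realType) (T : R) (c c1 c2 c12 c22 : R * R -> R * R).
Hypothesis T0 : 0 < T.
Hypothesis cd1 : forall t s : R, t \in `[0, T] -> s \in `[0, 1] ->
  is_derive (t, s) e1 c (c1 (t, s)).
Hypothesis cd2 : forall t s : R, t \in `[0, T] -> s \in `[0, 1] ->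
  is_derive (t, s) e2 c (c2 (t, s)).
Hypothesis cd12 : forall t s : R, t \in `[0, T] -> s \in `[0, 1] ->
  is_derive (t, s) e1 c2 (c12 (t, s)).
Hypothesis cd22 : forall t s : R, t \in `[0, T] -> s \in `[0, 1] ->
  is_derive (t, s) e2 c2 (c22 (t, s)).
Hypothesis c1c : forall t s : R, t \in `[0, T] -> s \in `[0, 1] ->
  {for (t, s), continuous c1}.
Hypothesis c2c : forall t s : R, t \in `[0, T] -> s \in `[0, 1] ->
  {for (t, s), continuous c2}.
Hypothesis c12c : forall t s : R, t \in `[0, T] -> s \in `[0, 1] ->
  {for (t, s), continuous c12}.
Hypothesis c22c : forall t s : R, t \in `[0, T] -> s \in `[0, 1] ->
  {for (t, s), continuous c22}.
Hypothesis c2_neq0 : forall t s : R, t \in `[0, T] -> s \in `[0, 1] ->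
  c2 (t, s) <> 0.
Hypothesis cinj : forall t : R, t \in `[0, T] ->
  {in `[0, 1] &, injective (fun s => c (t, s))}.

Let tau p := (enorm (c2 p))^-1 *: c2 p.

Lemma mixed_derivative_plane (t s : R) : t \in `[0, T] -> s \in `]0, 1[ ->
  is_derive s 1 (fun z => c1 (t, z)) (c12 (t, s)).
Proof.
move=> tT s01.
have h1 : is_derive s 1 (fun z => (c1 (t, z)).1) (c12 (t, s)).1.
  have d1 (r z : R) (rT : r \in `[0, T]) (z01 : z \in `[0, 1]) :=
    is_derive_fst (cd1 rT z01).
  have d2 (r z : R) (rT : r \in `[0, T]) (z01 : z \in `[0, 1]) :=
    is_derive_fst (cd2 rT z01).
  have d12 (r z : R) (rT : r \in `[0, T]) (z01 : z \in `[0, 1]) :=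
    is_derive_fst (cd12 rT z01).
  have k2 (r z : R) (rT : r \in `[0, T]) (z01 : z \in `[0, 1]) :=
    cvg_fst_comp (c2c rT z01).
  have k12 (r z : R) (rT : r \in `[0, T]) (z01 : z \in `[0, 1]) :=
    cvg_fst_comp (c12c rT z01).
  exact: (@mixed_derivative R T (fun p => (c p).1) (fun p => (c1 p).1)
    (fun p => (c2 p).1) (fun p => (c12 p).1) T0 d1 d2 d12 k2 k12 t s tT s01).
have h2 : is_derive s 1 (fun z => (c1 (t, z)).2) (c12 (t, s)).2.
  have d1 (r z : R) (rT : r \in `[0, T]) (z01 : z \in `[0, 1]) :=
    is_derive_snd (cd1 rT z01).
  have d2 (r z : R) (rT : r \in `[0, T]) (z01 : z \in `[0, 1]) :=
    is_derive_snd (cd2 rT z01).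
  have d12 (r z : R) (rT : r \in `[0, T]) (z01 : z \in `[0, 1]) :=
    is_derive_snd (cd12 rT z01).
  have k2 (r z : R) (rT : r \in `[0, T]) (z01 : z \in `[0, 1]) :=
    cvg_snd_comp (c2c rT z01).
  have k12 (r z : R) (rT : r \in `[0, T]) (z01 : z \in `[0, 1]) :=
    cvg_snd_comp (c12c rT z01).
  exact: (@mixed_derivative R T (fun p => (c p).2) (fun p => (c1 p).2)
    (fun p => (c2 p).2) (fun p => (c12 p).2) T0 d1 d2 d12 k2 k12 t s tT s01).
have := is_derive_pair h1 h2; rewrite -surjective_pairing.
by under eq_fun do rewrite -surjective_pairing.
Qed.

Let tau' (t s : R) := derive_unit (fun z => c2 (t, z)) (c22 (t, s)) s.

Let slice_d2 (t s : R) : t \in `[0, T] -> s \in `[0, 1] ->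
  is_derive s 1 (fun z => c (t, z)) (c2 (t, s)).
Proof. by move=> tT s01; apply/slice2E; exact: cd2. Qed.

Let slice_c2 (t s : R) : t \in `[0, T] -> s \in `[0, 1] ->
  {for s, continuous (fun z => c2 (t, z))}.
Proof. by move=> tT s01; apply: slice2_continuous; exact: c2c. Qed.

Lemma tangent_derive (t s : R) : t \in `[0, T] -> s \in `[0, 1] ->
  is_derive s 1 (fun z => tau (t, z)) (tau' t s).
Proof.
move=> tT s01; apply: (is_derive_unit ((slice2E _ _ _ _).1 (cd22 tT s01))).
exact: c2_neq0.
Qed.

Lemma tangent_derive_continuous (t s : R) : t \in `[0, T] -> s \in `[0, 1] ->
  {for s, continuous (tau' t)}.
Proof.
move=> tT s01.
have c2s := slice_c2 tT s01.
have c22s : {for s, continuous (fun z => c22 (t, z))}.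
  by apply: slice2_continuous; exact: c22c.
have n0 : c2 (t, s) <> 0 by exact: c2_neq0.
have invc : (enorm (c2 (t, z)))^-1 @[z --> s] --> (enorm (c2 (t, s)))^-1.
  exact: cvg_enormV.
exact: (cvgB (cvgZ invc c22s)
  (cvgZ (cvgM (cvgM invc invc) (cvg_dot (cvgZ invc c2s) c22s)) c2s)).
Qed.

Lemma arc_length_slice (t : R) : t \in `[0, T] ->
  \int[H1 R]_(x in (fun s => c (t, s)) @` `[0, 1]) 1 =
  \int[lebesgue_measure]_(s in `[0, 1]) enorm (c2 (t, s)).
Proof.
move=> tT.
exact: (@arc_length R (fun s => c (t, s)) (fun s => c2 (t, s))
  (fun s => slice_d2 tT) (fun s => slice_c2 tT) (cinj tT)).
Qed.

(** The speed has time derivative tau . c12, and c12 is also the derivative of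
the velocity c1 along the arc; integration by parts moves this derivative onto
tau. *)
Lemma first_variation (t : R) : t \in `[0, T] ->
  is_derive_within `[0, T]
    (fun r => \int[H1 R]_(x in (fun s => c (r, s)) @` `[0, 1]) 1) t
    (dot (tau (t, 1)) (c1 (t, 1)) - dot (tau (t, 0)) (c1 (t, 0)) -
     \int[lebesgue_measure]_(s in `[0, 1]) dot (c1 (t, s)) (tau' t s)).
Proof.
move=> tT.
have taud (r s : R) : r \in `[0, T] -> s \in `[0, 1] ->
    is_derive (r, s) e1 (fun p => enorm (c2 p)) (dot (tau (r, s)) (c12 (r, s))).
  move=> rT s01; apply/slice1E.
  apply: (@is_derive_enorm R (fun z => c2 (z, s)) _ _
    ((slice1E _ _ _ _).1 (cd12 rT s01))).
  exact: c2_neq0.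
have tauc (r s : R) : r \in `[0, T] -> s \in `[0, 1] -> {for (r, s), continuous tau}.
  by move=> rT s01; apply: cvg_unit; [exact: c2_neq0|exact: c2c].
have dtauc (r s : R) : r \in `[0, T] -> s \in `[0, 1] ->
    {for (r, s), continuous (fun p => dot (tau p) (c12 p))}.
  by move=> rT s01; apply: cvg_dot; [exact: tauc|exact: c12c].
have spc (r s : R) : r \in `[0, T] -> s \in `[0, 1] ->
    {for s, continuous (fun z => enorm (c2 (r, z)))}.
  by move=> rT s01; apply: cvg_enorm; exact: slice_c2.
have := @derive_within_under_integral R T 0 1 (fun p => enorm (c2 p))
  (fun p => dot (tau p) (c12 p)) ler01 taud dtauc spc t tT.
set D := Rintegral _ _ _ => lD.
suff <- : D = dot (tau (t, 1)) (c1 (t, 1)) - dot (tau (t, 0)) (c1 (t, 0)) -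
     \int[lebesgue_measure]_(s in `[0, 1]) dot (c1 (t, s)) (tau' t s).
  by apply: eq_is_derive_within lD => // r rT; rewrite arc_length_slice.
have c1s (s : R) : s \in `[0, 1] -> {for s, continuous (fun z => c1 (t, z))}.
  by move=> s01; apply: slice2_continuous; exact: c1c.
have kc (s : R) : s \in `[0, 1] ->
    {for s, continuous (fun z => dot (c1 (t, z)) (tau' t z))}.
  by move=> s01; apply: cvg_dot; [exact: c1s|exact: tangent_derive_continuous].
have dc (s : R) : s \in `[0, 1] ->
    {for s, continuous (fun z => dot (tau (t, z)) (c12 (t, z)))}.
  move=> s01; apply: (@slice2_continuous _ _ (fun p => dot (tau p) (c12 p))).
  exact: dtauc.
apply/eqP; rewrite eq_sym subr_eq eq_sym; apply/eqP.
rewrite /D -RintegralD//; [|exact: itv_integrable..].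
have gd (s : R) : s \in `]0, 1[ ->
    is_derive s 1 (fun s => dot (tau (t, s)) (c1 (t, s)))
      (dot (tau (t, s)) (c12 (t, s)) + dot (c1 (t, s)) (tau' t s)).
  move=> s01; have s01' : s \in `[0, 1] by exact: subset_itv_oo_cc.
  apply: (is_derive_eq (is_derive_dot (tangent_derive tT s01')
    (mixed_derivative_plane tT s01))).
  by rewrite addrC [dot (tau' t s) _]dotC.
apply: (@Rintegral_derive R 0 1 (fun s => dot (tau (t, s)) (c1 (t, s))) _
  ltr01 gd).
- apply: for_within_continuous => s s01; apply: cvg_dot; last exact: c1s.
  by apply: (@slice2_continuous _ _ tau); exact: tauc.
- by apply: for_within_continuous => s s01; apply: cvgD; [exact: dc|exact: kc].
Qed.

End first_variation.

(** * Finite sums of integrals *)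

Section finite_sums.
Variable R : realType.
Context d (T : measurableType d) (mu : {measure set T -> \bar R}).
Implicit Types (D : set T) (f g : T -> R).

Lemma integrable_sumR (I : Type) (r : seq I) D (f : I -> T -> R) :
  measurable D -> (forall i, mu.-integrable D (EFin \o f i)) ->
  mu.-integrable D (EFin \o (fun x => \sum_(i <- r) f i x)).
Proof.
move=> mD fi.
rewrite (_ : EFin \o _ = fun x => (\sum_(i <- r) (EFin \o f i) x)%E).
  exact: integrable_sum.
by apply/funext => x; rewrite /= sumEFin.
Qed.

Lemma Rintegral_sum (I : Type) (r : seq I) D (f : I -> T -> R) :
  measurable D -> (forall i, mu.-integrable D (EFin \o f i)) ->
  \int[mu]_(x in D) (\sum_(i <- r) f i x) = \sum_(i <- r) \int[mu]_(x in D) f i x.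
Proof.
move=> mD fi; elim: r => [|i r ih].
  by under eq_fun do rewrite big_nil; rewrite big_nil Rintegral_cst// mul0r.
under eq_fun do rewrite big_cons.
by rewrite big_cons RintegralD ?ih//; exact: integrable_sumR.
Qed.

Lemma Rintegral_bigsetU (I : choiceType) (r : seq I) (D : I -> set T) f :
  (forall i, measurable (D i)) -> uniq r -> trivIset [set` r] D ->
  mu.-integrable (\big[setU/set0]_(i <- r) D i) (EFin \o f) ->
  \int[mu]_(x in \big[setU/set0]_(i <- r) D i) f x =
  \sum_(i <- r) \int[mu]_(x in D i) f x.
Proof.
move=> mD ur tr fi; rewrite /Rintegral integral_bigsetU_EFin//; last first.
  exact: measurable_int fi.
rewrite big_seq [RHS]big_seq -sum_fine// => i ir; apply: integrable_fin_num => //.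
have sub : D i `<=` \big[setU/set0]_(i <- r) D i.
  by rewrite -bigcup_seq; exact: bigcup_sup.
by apply: integrableS sub fi => //; exact: bigsetU_measurable.
Qed.

Lemma integrable_mul_bounded D f g (K : R) : measurable D ->
  measurable_fun D f -> (forall x, D x -> `|f x| <= K) ->
  mu.-integrable D (EFin \o g) -> mu.-integrable D (EFin \o (fun x => f x * g x)).
Proof.
move=> mD mf fK gi.
have fb : [bounded f x | x in D].
  exists K; split; first exact: num_real.
  by move=> M KM x Dx /=; rewrite (le_trans (fK x Dx))// ltW.
exact: (integrableMr mD mf fb gi).
Qed.

(** For traces, whose values at the two junctions carry no information. *)
Lemma eq_integrable_off_pair D f g (a b : T) :
  measurable D -> measurable [set a] -> measurable [set b] ->
  mu [set a; b] = 0%E ->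
  (forall x, D x -> ~ [set a; b] x -> f x = g x) ->
  mu.-integrable D (EFin \o f) -> mu.-integrable D (EFin \o g).
Proof.
move=> mD ma mb ab0 fg fi.
have mab : measurable [set a; b] by exact: measurableU.
have mDab : measurable (D `\` [set a; b]) by exact: measurableD.
have eq_fg : {in D `\` [set a; b], EFin \o f =1 EFin \o g}.
  by move=> x; rewrite inE => -[Dx abx] /=; rewrite fg.
have fi' : mu.-integrable (D `\` [set a; b]) (EFin \o f).
  by apply: integrableS fi => //; exact: subDsetl.
have gi' : mu.-integrable (D `\` [set a; b]) (EFin \o g).
  exact: eq_integrable mDab _ _ eq_fg fi'.
apply/(@negligible_integrable _ _ _ mu D [set a; b]) => //.
apply: (@measurable_funS _ _ _ _ (D `\` [set a; b] `|` [set a; b])).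
- exact: measurableU.
- by move=> x Dx; have [?|?] := pselect ([set a; b] x); [right|left].
apply/measurable_funU => //; split; first exact: measurable_int gi'.
by apply/measurable_funU => //; split; exact: measurable_fun_set1.
Qed.

End finite_sums.

(** * The field u grad u *)

Section gradient_field.
Variables (R : realType) (D C : set (R * R)) (u : R * R -> R).
Hypotheses (oD : open D) (DC : D `<=` C).
Hypothesis uc : {within C, continuous u}.
Hypothesis u2 : C2_on D u.

Let F (y : R * R) : R * R := u y *: grad u y.

Lemma within_cvg (A : set (R * R)) x : A `<=` C -> C x ->
  u y @[y --> within A (nbhs x)] --> u x.
Proof.
move=> AC Cx; move/subspace_continuousP : uc => /(_ x Cx).
by apply: cvg_trans; apply: cvg_app; exact: within_subset.
Qed.

Lemma interior_continuous x : D x -> {for x, continuous u}.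
Proof.
move=> Dx; have := within_cvg DC (DC Dx).
by rewrite within_interior//; exact: open_nbhs_nbhs.
Qed.

Let u1 a x : a \in [:: e1; e2] -> D x -> is_derive x a u ('D_a u x).
Proof.
have [h _ _] := u2; move=> + Dx; have [d1 d2 _ _] := h _ Dx.
by rewrite !inE => /orP[]/eqP->; [exact: DeriveDef d1 erefl|exact: DeriveDef d2 erefl].
Qed.

Let u11 a x : a \in [:: e1; e2] -> D x -> is_derive x a ('D_e1 u) ('D_a ('D_e1 u) x).
Proof.
have [_ h _] := u2; move=> + Dx; have [d1 d2 _ _] := h _ Dx.
by rewrite !inE => /orP[]/eqP->; [exact: DeriveDef d1 erefl|exact: DeriveDef d2 erefl].
Qed.

Let u12 a x : a \in [:: e1; e2] -> D x -> is_derive x a ('D_e2 u) ('D_a ('D_e2 u) x).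
Proof.
have [_ _ h] := u2; move=> + Dx; have [d1 d2 _ _] := h _ Dx.
by rewrite !inE => /orP[]/eqP->; [exact: DeriveDef d1 erefl|exact: DeriveDef d2 erefl].
Qed.

Let uc1 a x : a \in [:: e1; e2] -> D x -> {for x, continuous ('D_a u)}.
Proof.
have [h _ _] := u2; move=> + Dx; have [_ _ d1 d2] := h _ Dx.
by rewrite !inE => /orP[]/eqP->; [exact: d1|exact: d2].
Qed.

Let uc11 a x : a \in [:: e1; e2] -> D x -> {for x, continuous ('D_a ('D_e1 u))}.
Proof.
have [_ h _] := u2; move=> + Dx; have [_ _ d1 d2] := h _ Dx.
by rewrite !inE => /orP[]/eqP->; [exact: d1|exact: d2].
Qed.

Let uc12 a x : a \in [:: e1; e2] -> D x -> {for x, continuous ('D_a ('D_e2 u))}.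
Proof.
have [_ _ h] := u2; move=> + Dx; have [_ _ d1 d2] := h _ Dx.
by rewrite !inE => /orP[]/eqP->; [exact: d1|exact: d2].
Qed.

Let dF a y : R * R := 'D_a u y *: grad u y + u y *: ('D_a ('D_e1 u) y, 'D_a ('D_e2 u) y).

Let is_derive_F a x : a \in [:: e1; e2] -> D x -> is_derive x a F (dF a x).
Proof.
move=> ae Dx.
exact: is_derive_scale (u1 ae Dx) (is_derive_pair (u11 ae Dx) (u12 ae Dx)).
Qed.

Lemma grad_continuous x : D x -> {for x, continuous (grad u)}.
Proof.
move=> Dx.
have e1m : e1 \in [:: e1; e2 : R * R] by rewrite !inE eqxx.
have e2m : e2 \in [:: e1; e2 : R * R] by rewrite !inE eqxx orbT.
exact: (cvg_pair (uc1 e1m Dx) (uc1 e2m Dx)).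
Qed.

Lemma gradient_field_C1 : C1_on D F.
Proof.
move=> x Dx.
have e1m : e1 \in [:: e1; e2 : R * R] by rewrite !inE eqxx.
have e2m : e2 \in [:: e1; e2 : R * R] by rewrite !inE eqxx orbT.
have cont a : a \in [:: e1; e2] -> {for x, continuous ('D_a F)}.
  move=> ae.
  have : {for x, continuous (dF a)}.
    have cu := interior_continuous Dx; have cg := grad_continuous Dx.
    have cdg : {for x, continuous
        (fun y => ('D_a ('D_e1 u) y, 'D_a ('D_e2 u) y) : R * R)}.
      exact: (cvg_pair (uc11 ae Dx) (uc12 ae Dx)).
    exact: (cvgD (cvgZ (uc1 ae Dx) cg) (cvgZ cu cdg)).
  have near_eq : {near x, dF a =1 'D_a F}.
    have : nbhs x D by exact: open_nbhs_nbhs.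
    by apply: filterS => y Dy; have [] := is_derive_F ae Dy.
  have eqx : 'D_a F x = dF a x by have [] := is_derive_F ae Dx.
  move=> cd; suff : 'D_a F y @[y --> x] --> dF a x by rewrite -eqx.
  by apply: cvg_trans cd; exact: near_eq_cvg.
split; [by have [] := is_derive_F e1m Dx|by have [] := is_derive_F e2m Dx|exact: cont|exact: cont].
Qed.

Lemma divergence_gradient_field x : D x -> laplacian u x = 0 ->
  divergence F x = enorm (grad u x) ^+ 2.
Proof.
move=> Dx lap.
have e1m : e1 \in [:: e1; e2 : R * R] by rewrite !inE eqxx.
have e2m : e2 \in [:: e1; e2 : R * R] by rewrite !inE eqxx orbT.
have [_ d1] := is_derive_fst (is_derive_F e1m Dx).
have [_ d2] := is_derive_snd (is_derive_F e2m Dx).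
rewrite /divergence -[fst \o F]/(fun y => (F y).1) -[snd \o F]/(fun y => (F y).2).
rewrite d1 d2 enorm_sqr /dot /dF /=.
move: lap; rewrite /laplacian.
move: ('D_e1 u x) ('D_e2 u x) ('D_e1 _ x) ('D_e2 _ x) (u x) => p q r s v rs.
rewrite /GRing.scale /= addrACA -mulrDr rs mulr0 addr0.
by [].
Qed.

Lemma trace_gradient_field x : C x -> has_trace D (grad u) x ->
  F y @[y --> within D (nbhs x)] --> u x *: trace D (grad u) x.
Proof. by move=> Cx tr; apply: cvgZ; [exact: within_cvg|exact: tr]. Qed.

End gradient_field.

(** * Geometry of the network *)

Section indices.
Implicit Types i j : 'I_3.

Lemma ordS_neq i : ordS i != i.
Proof. by case: i => [[|[|[|//]]] ?]; rewrite -val_eqE. Qed.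

Lemma ord_pred_neq i : ord_pred i != i.
Proof. by case: i => [[|[|[|//]]] ?]; rewrite -val_eqE. Qed.

Lemma other_index i j : i != j -> i = ord_pred j \/ i = ordS j.
Proof.
case: i => [[|[|[|//]]] ?]; case: j => [[|[|[|//]]] ?]; rewrite -val_eqE //= => _;
  first [by left; apply: val_inj|by right; apply: val_inj].
Qed.

End indices.

Section network_facts.
Variables (R : realType) (Omega : set (R * R)) (nuO : R * R -> R * R).
Variables (N : network R) (t : R).
Hypothesis hO : is_bounded_domain Omega nuO.
Hypothesis hN : is_network Omega N t.
Hypothesis hL : forall i, exists2 L, 0 <= L &
  lipschitz_arc 0 1 L (fun s => curve N i (t, s)).
Implicit Types (i j : 'I_3) (x : R * R) (s : R).

Lemma Gamma_compact i : compact (Gamma N i t).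
Proof. by have [L _ cL] := hL i; exact: arc_compact cL. Qed.

Lemma Gamma_closed i : closed (Gamma N i t).
Proof. by have /(compact_closed (@hausdorff_plane R)) := @Gamma_compact i. Qed.

Lemma Gamma_measurable i :
  measurable (Gamma N i t : set (caratheodory_type (hausdorff1_outer R))).
Proof. by have [L _ cL] := hL i; exact: arc_measurable_H1 cL. Qed.

Lemma Gammas_bigsetU : Gammas N t = \big[setU/set0]_(i <- enum 'I_3) Gamma N i t.
Proof.
rewrite -bigcup_seq; apply/seteqP; split => x [i _ Gx]; exists i => //=.
by rewrite mem_enum.
Qed.

Lemma Gammas_closed : closed (Gammas N t).
Proof.
by apply: closed_bigcup => [|i _]; [exact: finite_finset|exact: Gamma_closed].
Qed.

Lemma Gammas_L2 : L2 R (Gammas N t) = 0%E.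
Proof.
have mG i : measurable (Gamma N i t : set (measurableTypeR R * measurableTypeR R)).
  by have [L _ cL] := hL i; exact: arc_measurable_L2 cL.
rewrite Gammas_bigsetU.
have [mB ->] : measurable (\big[setU/set0]_(i <- enum 'I_3) Gamma N i t :
    set (measurableTypeR R * measurableTypeR R)) /\
    L2 R (\big[setU/set0]_(i <- enum 'I_3) Gamma N i t) = 0%E; last by [].
elim/big_ind : _ => [|A B [mA A0] [mB B0]|i _].
- by split; [exact: measurable0|exact: measure0].
- by split; [exact: measurableU|exact: null_set_setU].
- have [L L0 cL] := hL i; split; first exact: mG.
  exact: L2_arc ler01 L0 cL.
Qed.

Lemma junctionsE i : junctions N t = [set curve N i (t, 0); curve N i (t, 1)].
Proof. by rewrite /junctions (curve_start hN _ i) (curve_stop hN _ i). Qed.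

Lemma junctions_null : H1 R (junctions N t) = 0%E.
Proof.
apply/eqP; rewrite eq_le measure_ge0 andbT.
by rewrite (le_trans (outer_measureU2 (hausdorff1_outer R) _ _))// !H1_point adde0.
Qed.

Lemma junctions_sub i : junctions N t `<=` Gamma N i t.
Proof.
rewrite (junctionsE i) => x [] ->; [exists 0|exists 1] => //=;
  by rewrite in_itv/= lexx ler01.
Qed.

Lemma interior_not_junction i s : s \in `]0, 1[ ->
  ~ junctions N t (curve N i (t, s)).
Proof.
move=> s01; have s01' : s \in `[0, 1] by exact: subset_itv_oo_cc.
rewrite (junctionsE i) => -[] /(curve_injective hN) se; move: s01;
  rewrite se// ?in_itv/= ?lexx ?ler01 ?ltxx ?andbF//.
Qed.

Lemma phase_sub j : phase N j t `<=` Omega `\` Gammas N t.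
Proof. by rewrite -(phase_cover hN) => x px; exists j. Qed.

Lemma phase_sub_Omega j : phase N j t `<=` Omega.
Proof. by move=> x /phase_sub[]. Qed.

Lemma Gamma_closure_phase i j : i != j -> Gamma N i t `<=` closure (phase N j t).
Proof.
move=> ij x Gx; suff : frontier (phase N j t) x by case.
rewrite (phase_frontier hN); left.
by have [<-|<-] := other_index ij; [left|right].
Qed.

Lemma closure_phase_Omega j : closure (phase N j t) `<=` closure Omega.
Proof. exact/closure_subset/phase_sub_Omega. Qed.

Lemma Gamma_closure_Omega i : Gamma N i t `<=` closure Omega.
Proof. by move=> x /(curve_inside hN); exact: subset_closure. Qed.

Lemma closure_inner_phase j : j != ord_max -> closure (phase N j t) `<=` Omega.
Proof.
move=> jmax x cx; have [ix|ix] := pselect ((phase N j t)° x).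
  by apply: (@phase_sub_Omega j); exact: interior_subset.
have : frontier (phase N j t) x by split.
by rewrite (phase_frontier hN) (negbTE jmax) setU0 => -[] /(curve_inside hN).
Qed.

Lemma frontier_not_in x : frontier Omega x -> ~ Omega x.
Proof.
by move=> [_ ix] Ox; apply: ix; exact: (open_nbhs_nbhs (conj (domain_open hO) Ox)).
Qed.

Lemma frontier_closure_phase x : frontier Omega x -> closure (phase N ord_max t) x.
Proof.
move=> fx; suff : frontier (phase N ord_max t) x by case.
by rewrite (phase_frontier hN) eqxx; right.
Qed.

Lemma frontier_not_junction x : frontier Omega x -> ~ junctions N t x.
Proof.
move=> /frontier_not_in Ox /(@junctions_sub ord0)/(curve_inside hN).
exact: Ox.
Qed.

(** The curves and the closures of the two inner phases lie in Omega, away from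
its boundary.  Hence traces at the boundary from Omega and from the outer phase
are the same. *)
Lemma near_frontier x : frontier Omega x ->
  within Omega (nbhs x) = within (phase N ord_max t) (nbhs x).
Proof.
move=> fx; have nOx := frontier_not_in fx.
pose B := Gammas N t `|` \big[setU/set0]_(j <- enum 'I_3 | j != ord_max)
  closure (phase N j t).
have Bc : closed B.
  apply: closedU; first exact: Gammas_closed.
  rewrite -bigcup_seq_cond; apply: closed_bigcup => [|j _].
    exact: finite_finset.
  exact: closed_closure.
have Bx : ~ B x.
  case=> [[i _ /(curve_inside hN)//]|].
  rewrite -bigcup_seq_cond => -[j /= /andP[_ jmax]].
  by move=> /(closure_inner_phase jmax).
have nB : nbhs x (~` B) by apply: open_nbhs_nbhs; split => //; exact: closed_openC.
have D_Om y : (~` B) y -> Omega y -> phase N ord_max t y.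
  move=> nBy Oy; have : (Omega `\` Gammas N t) y.
    by split => // Gy; apply: nBy; left.
  rewrite -(phase_cover hN) => -[j _ py].
  have [<-//|jmax] := eqVneq j ord_max.
  exfalso; apply: nBy; right; rewrite -bigcup_seq_cond; exists j.
    by rewrite /= mem_enum.
  exact: subset_closure.
apply/seteqP; split => A; rewrite /within /=.
  by apply: filterS => y h py; apply: h; exact: phase_sub_Omega py.
by move=> h; apply: filterS (filterI nB h) => y [nBy h'] Oy; apply/h'/D_Om.
Qed.

Lemma closure_Omega_compact : compact (closure Omega).
Proof.
have [M [_ MO]] := domain_bounded hO; pose K := M + 1.
have MK : M < K by rewrite /K ltrDl.
have boxc : compact (`[- K, K]%classic `*` `[- K, K]%classic : set (R * R)).
  by apply: compact_setX; exact: segment_compact.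
apply: (subclosed_compact _ boxc); first exact: closed_closure.
have /(compact_closed (@hausdorff_plane R))/closure_id -> := boxc.
apply: closure_subset => x /(MO _ MK) xK.
by split => /=; rewrite in_itv/= -ler_norml (le_trans _ xK)// prod_normE le_max lexx ?orbT.
Qed.

End network_facts.

(** * Dissipation as a sum of line integrals *)

Section dissipation.
Variables (R : realType) (Omega : set (R * R)) (nuO : R * R -> R * R).
Variables (sigma : 'I_3 -> R) (N : network R) (w : 'I_3 -> R * R -> R) (t : R).
Hypothesis hO : is_bounded_domain Omega nuO.
Hypothesis hN : is_network Omega N t.
Hypothesis hL : forall i, exists2 L, 0 <= L &
  lipschitz_arc 0 1 L (fun s => curve N i (t, s)).
Hypothesis hG : forall j, gauss_green Omega nuO N j t.
Hypothesis hR : is_regular Omega N w t.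
Hypothesis hM : mullins_sekerka Omega nuO sigma N w t.
Implicit Types (i j k : 'I_3) (x y : R * R) (s : R).

Let F k y : R * R := w k y *: grad (w k) y.
Let q j k i x : R := dot (trace (phase N j t) (F k) x) (normal N i t x).

Let phase_C2 j k : C2_on (phase N j t) (w k).
Proof.
have [h h1 h2] := w_C2 hR k.
by split => x /(phase_sub hN) Dx; [exact: h|exact: h1|exact: h2].
Qed.

Let phase_closure j : phase N j t `<=` closure Omega.
Proof. by move=> x /(phase_sub_Omega hN); exact: subset_closure. Qed.

Lemma w_bounded k : exists K : R, forall x, closure Omega x -> `|w k x| <= K.
Proof.
have /compact_bounded[M [_ MK]] : compact (w k @` closure Omega).
  apply: continuous_compact; first exact: (w_continuous hR).
  exact: closure_Omega_compact hO.
by exists (M + 1) => x cx; apply: (MK (M + 1)); rewrite ?ltrDl//; exists x.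
Qed.

Lemma trace_cvg j k x : closure (phase N j t) x -> ~ junctions N t x ->
  F k y @[y --> within (phase N j t) (nbhs x)] -->
  w k x *: trace (phase N j t) (grad (w k)) x.
Proof.
move=> cx jx; apply: (trace_gradient_field (@phase_closure j) (w_continuous hR (k := k))).
  exact: (closure_phase_Omega hN cx).
exact: (w_trace hR).
Qed.

Lemma traceF j k x : closure (phase N j t) x -> ~ junctions N t x ->
  trace (phase N j t) (F k) x = w k x *: trace (phase N j t) (grad (w k)) x.
Proof.
move=> cx jx; have ? : ProperFilter (within (phase N j t) (nbhs x)).
  exact: within_nbhs_proper.
by apply: cvg_lim; [exact: norm_hausdorff|exact: trace_cvg].
Qed.

(** Off the junctions the flux of w grad w is the bounded function w times the
flux of grad w. *)
Lemma flux_integrable i j k : i != j ->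
  (H1 R).-integrable (Gamma N i t) (EFin \o q j k i).
Proof.
move=> ij; have [K wK] := w_bounded k.
have mG := Gamma_measurable hL i.
apply: (@eq_integrable_off_pair R _ _ (H1 R) _ (fun x => w k x *
    dot (trace (phase N j t) (grad (w k)) x) (normal N i t x)) _
    (curve N ord0 (t, 0)) (curve N ord0 (t, 1))) => //.
- exact: measurable_point.
- exact: measurable_point.
- exact: junctions_null.
- move=> x Gx jx; rewrite /q traceF//; first by rewrite dotZl.
  exact: (Gamma_closure_phase hN ij).
apply: (@integrable_mul_bounded R _ _ (H1 R) _ (w k) _ K) => //.
- apply: (@within_continuous_measurable R _ _ _ (Gamma N i t) (w k) (@borel_H1 R) mG).
  apply: continuous_subspaceW (w_continuous hR (k := k)).
  by move=> y Gy; exact: (Gamma_closure_Omega hN Gy).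
- by move=> x Gx; apply: wK; exact: (Gamma_closure_Omega hN Gx).
- exact: (w_flux hR).
Qed.

Lemma outer_flux k x : frontier Omega x ->
  dot (trace (phase N ord_max t) (F k) x) (nuO x) = 0.
Proof.
move=> fx; rewrite traceF; last 2 first.
- exact: (frontier_closure_phase hN).
- exact: (frontier_not_junction hO hN).
have := neumann hM k fx.
by rewrite dotZl /trace (near_frontier hO hN hL fx) => ->; rewrite mulr0.
Qed.

Let mphase j :
  measurable (phase N j t : set (measurableTypeR R * measurableTypeR R)).
Proof. by apply: (@borel_L2 R (phase N j t)); exact: phase_open hN _. Qed.

Let mOmega : measurable (Omega : set (measurableTypeR R * measurableTypeR R)).
Proof. by apply: (@borel_L2 R Omega); exact: domain_open hO. Qed.

Let energy_phase j k : (L2 R).-integrable (phase N j t)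
  (EFin \o (fun x => enorm (grad (w k) x) ^+ 2)).
Proof.
apply: (integrableS mOmega) => //; first by move=> y py; exact: (phase_sub_Omega hN py).
exact: (w_energy hR).
Qed.

Let div_phase j k x : phase N j t x ->
  divergence (F k) x = enorm (grad (w k) x) ^+ 2.
Proof.
move=> px; apply: (divergence_gradient_field (@phase_C2 j k)) => //.
by apply: (w_harmonic hM); exact: (phase_sub hN px).
Qed.

(** The Gauss-Green formula for w grad w, whose divergence is |grad w|^2 because
w is harmonic; the outer boundary drops out by the Neumann condition. *)
Lemma dissipation_phase j k :
  \int[L2 R]_(x in phase N j t) enorm (grad (w k) x) ^+ 2 =
  \int[H1 R]_(x in Gamma N (ord_pred j) t) q j k (ord_pred j) x -
  \int[H1 R]_(x in Gamma N (ordS j) t) q j k (ordS j) x.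
Proof.
have outer x : frontier Omega x ->
    dot (trace (phase N ord_max t) (F k) x) (nuO x) = 0 by exact: outer_flux.
have mfr : measurable (frontier Omega :
    set (caratheodory_type (hausdorff1_outer R))).
  apply: (@closed_measurable_plane _ _ _ _ (frontier Omega) (@borel_H1 R)).
  rewrite /frontier setDE; apply: closedI; first exact: closed_closure.
  by apply: open_closedC; exact: open_interior.
have C1F : C1_on (phase N j t) (F k).
  apply: (@gradient_field_C1 R (phase N j t) (closure Omega) (w k)).
  - exact: phase_open hN _.
  - exact: phase_closure.
  - exact: w_continuous hR _.
  - exact: phase_C2.
have [K wK] := w_bounded k.
have := hG (j := j) (F := F k).
move=> /(_ C1F).
rewrite (_ : \int[L2 R]_(x in phase N j t) divergence (F k) x =
  \int[L2 R]_(x in phase N j t) enorm (grad (w k) x) ^+ 2); last first.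
  by apply: eq_Rintegral => x; rewrite inE; exact: div_phase.
move=> ->.
- rewrite -[RHS]addr0; congr (_ + _); case: eqP => // jmax.
  rewrite jmax (@eq_Rintegral _ _ _ _ _ (fun=> 0)) ?Rintegral_cst ?mul0r//.
  by move=> x; rewrite inE => /outer.
- by move=> x [cx jx]; apply/cvg_ex; eexists; exact: trace_cvg.
- have wm : measurable_fun (phase N j t :
      set (measurableTypeR R * measurableTypeR R)) (w k).
    apply: (@within_continuous_measurable R _ _ _ (phase N j t) (w k)
      (@borel_L2 R) (mphase j)).
    by apply: continuous_subspaceW (w_continuous hR (k := k)); exact: phase_closure.
  have wK' x : phase N j t x -> `|w k x| <= K.
    by move=> px; apply: wK; exact: phase_closure px.
  have := integrable_mul_bounded (mphase j) wm wK'
    (integrable_mul_bounded (mphase j) wm wK' (energy_phase j k)).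
  apply: eq_integrable => // x _ /=.
  by rewrite /F enormZ exprMn real_normK ?num_real// expr2 mulrA.
- apply: (eq_integrable (mphase j) _ _ _ (energy_phase j k)) => x.
  by rewrite inE => px /=; congr EFin; apply/esym; exact: (@div_phase j k x px).
- by move=> i ij; exact: flux_integrable.
- move=> jmax; apply: (eq_integrable mfr (EFin \o (fun=> 0)) _ _ (integrable0 _ _)).
  by move=> x; rewrite inE => /outer fx /=; rewrite jmax fx.
Qed.

(** The normal line through a point of Gamma_i runs into the two adjacent
phases, so the one-sided limits along it are traces. *)
Lemma jump_traces i k s : s \in `]0, 1[ ->
  let x := curve N i (t, s) in
  jump (grad (w k)) (normal N i t x) x =
  trace (phase N (ord_pred i) t) (grad (w k)) x -
  trace (phase N (ordS i) t) (grad (w k)) x.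
Proof.
move=> s01 x; set n := normal N i t x.
have Gx : Gamma N i t x by exists s => //; exact: subset_itv_oo_cc.
have jx := interior_not_junction hN s01.
have [nS nP] : (\forall e \near 0^'+, phase N (ordS i) t (x - e *: n)) /\
    (\forall e \near 0^'+, phase N (ord_pred i) t (x + e *: n)).
  have := normal_oriented hN i s01; rewrite /= -/x -/n => no.
  by split; move: no; apply: filterS => e [].
have tr j : i != j -> grad (w k) y @[y --> within (phase N j t) (nbhs x)] -->
    trace (phase N j t) (grad (w k)) x.
  move=> ij; have h : has_trace (phase N j t) (grad (w k)) x.
    apply: (w_trace hR); split; last exact: jx.
    exact: (Gamma_closure_phase hN ij Gx).
  exact: h.
have line (m : R * R) : x + e *: m @[e --> 0^'+] --> x.
  rewrite -[X in _ --> X]addr0 -(scale0r m); apply: cvgD; first exact: cvg_cst.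
  apply: cvgZ; last exact: cvg_cst.
  by apply: cvg_within_filter; exact: cvg_id.
have side j (m : R * R) : (\forall e \near 0^'+, phase N j t (x + e *: m)) ->
    x + e *: m @[e --> 0^'+] --> within (phase N j t) (nbhs x).
  move=> near_m A; rewrite /within /= => hA.
  by apply: filterS2 near_m (line m _ hA) => e pe h; exact: (h pe).
have nS' : \forall e \near 0^'+, phase N (ordS i) t (x + e *: (- n)).
  by apply: filterS nS => e; rewrite scalerN.
apply: cvg_lim; first exact: norm_hausdorff.
apply: cvgB.
  apply: (cvg_comp _ _ (side _ _ nP)); apply: tr.
  by rewrite eq_sym ord_pred_neq.
under eq_fun do rewrite -scalerN.
apply: (cvg_comp _ _ (side _ _ nS')); apply: tr.
by rewrite eq_sym ordS_neq.
Qed.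

Let g i x := \sum_(k < 3) (q (ordS i) k i x - q (ord_pred i) k i x).

Lemma interface_flux_integrable i : (H1 R).-integrable (Gamma N i t) (EFin \o g i).
Proof.
have mG := Gamma_measurable hL i.
apply: (integrable_sumR (mu := H1 R)) => // k.
have Si : i != ordS i by rewrite eq_sym ordS_neq.
have Pi : i != ord_pred i by rewrite eq_sym ord_pred_neq.
exact: (integrableB mG (flux_integrable k Si) (flux_integrable k Pi)).
Qed.

(** The jump of the normal derivative of w_k is the normal velocity times
- [chi_k], and the sum of the w_k [chi_k] is sigma_i times the curvature. *)
Lemma interface_flux i s : s \in `]0, 1[ ->
  g i (curve N i (t, s)) = sigma i * curvature N i t s * normal_velocity N i t s.
Proof.
move=> s01; have Gx : Gamma N i t (curve N i (t, s)).
  by exists s => //; exact: subset_itv_oo_cc.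
have jx := interior_not_junction hN s01.
rewrite /g -(gibbs_thomson hM i s01) mulr_suml; apply: eq_bigr => k _.
rewrite /q !traceF//; last 2 first.
- by apply: (Gamma_closure_phase hN _ Gx); rewrite eq_sym ord_pred_neq.
- by apply: (Gamma_closure_phase hN _ Gx); rewrite eq_sym ordS_neq.
rewrite !dotZl -mulrBr -dotBl -opprB -(jump_traces i k s01) dotNl.
by rewrite (interface_motion hM i k s01) mulNr opprK; ring.
Qed.

(** The curves have no area, and Gamma_i is met twice, with opposite signs, from
the two phases that it separates. *)
Lemma dissipation_interfaces :
  \int[L2 R]_(x in Omega) (\sum_(k < 3) enorm (grad (w k) x) ^+ 2) =
  \sum_(i < 3) \int[H1 R]_(x in Gamma N i t) g i x.
Proof.
have energy_int k : (L2 R).-integrable Omega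
    (EFin \o (fun x => enorm (grad (w k) x) ^+ 2)) := w_energy hR k.
have mGammas : measurable (Gammas N t : set (measurableTypeR R * measurableTypeR R)).
  exact: (@closed_measurable_plane _ _ _ _ (Gammas N t) (@borel_L2 R) (Gammas_closed hL)).
have phases : Omega `\` Gammas N t =
    \big[setU/set0]_(j <- enum 'I_3) phase N j t.
  rewrite -(phase_cover hN) -bigcup_seq.
  by apply/seteqP; split => x [j _ px]; exists j => //=; rewrite mem_enum.
have split_phases k : \int[L2 R]_(x in Omega) enorm (grad (w k) x) ^+ 2 =
    \sum_(j < 3) \int[L2 R]_(x in phase N j t) enorm (grad (w k) x) ^+ 2.
  rewrite (Rintegral_setD_null mGammas mOmega (energy_int k) (Gammas_L2 hL)).
  rewrite phases Rintegral_bigsetU ?enum_uniq//; first by rewrite big_enum.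
    move=> j j' _ _ /set0P/eqP; apply: contra_notP => /eqP jj'.
    exact: (phase_disjoint hN jj').
  rewrite -phases; apply: (integrableS mOmega) => //.
  by apply: measurableD.
rewrite (Rintegral_sum (mu := L2 R)) //.
under eq_bigr do rewrite split_phases.
rewrite exchange_big /=.
under eq_bigr => j _ do (under eq_bigr do rewrite dissipation_phase; rewrite sumrB).
rewrite sumrB (reindex_inj (@ordS_inj 3)) [X in _ - X](reindex_inj (@ord_pred_inj 3)) -sumrB.
apply: eq_bigr => i _; rewrite ordSK ord_predK -sumrB.
have mG := Gamma_measurable hL i.
have Si : i != ordS i by rewrite eq_sym ordS_neq.
have Pi : i != ord_pred i by rewrite eq_sym ord_pred_neq.
rewrite /g (Rintegral_sum (mu := H1 R))// => [|k].
  by apply: eq_bigr => k _; rewrite RintegralB//; exact: flux_integrable.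
exact: (integrableB mG (flux_integrable k Si) (flux_integrable k Pi)).
Qed.

End dissipation.

(** * The energy identity *)

Section energy.
Variables (R : realType) (Omega : set (R * R)) (nuO : R * R -> R * R).
Variables (sigma : 'I_3 -> R) (T : R) (Gamma0 : set (R * R)) (N : network R).
Variable w : R -> 'I_3 -> R * R -> R.
Hypothesis hO : is_bounded_domain Omega nuO.
Hypothesis T0 : 0 < T.
Hypothesis hw : is_strong_solution Omega nuO sigma T Gamma0 N w.
Implicit Types (i j k : 'I_3) (t s : R).

Let c i := curve N i.

Let smooth i t s : t \in `[0, T] -> s \in `[0, 1] ->
  [/\ derivable (c i) (t, s) e1, derivable (c i) (t, s) e2,
    {for (t, s), continuous ('D_e1 (c i))} &
    {for (t, s), continuous ('D_e2 (c i))}] /\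
  [/\ derivable ('D_e2 (c i)) (t, s) e1, derivable ('D_e2 (c i)) (t, s) e2,
    {for (t, s), continuous ('D_e1 ('D_e2 (c i)))} &
    {for (t, s), continuous ('D_e2 ('D_e2 (c i)))}].
Proof.
move=> tT s01; have [U [_ KU hU]] := solution_motion hw.
have Uts : U (t, s) by apply: KU.
by have [h1 h2] := hU i; split; [exact: h1|exact: h2].
Qed.

Let cd1 i t s : t \in `[0, T] -> s \in `[0, 1] ->
  is_derive (t, s) e1 (c i) ('D_e1 (c i) (t, s)).
Proof. by move=> tT s01; have [[h _ _ _] _] := smooth i tT s01; exact: DeriveDef h erefl. Qed.

Let cd2 i t s : t \in `[0, T] -> s \in `[0, 1] ->
  is_derive (t, s) e2 (c i) ('D_e2 (c i) (t, s)).
Proof. by move=> tT s01; have [[_ h _ _] _] := smooth i tT s01; exact: DeriveDef h erefl. Qed.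

Let cd12 i t s : t \in `[0, T] -> s \in `[0, 1] ->
  is_derive (t, s) e1 ('D_e2 (c i)) ('D_e1 ('D_e2 (c i)) (t, s)).
Proof. by move=> tT s01; have [_ [h _ _ _]] := smooth i tT s01; exact: DeriveDef h erefl. Qed.

Let cd22 i t s : t \in `[0, T] -> s \in `[0, 1] ->
  is_derive (t, s) e2 ('D_e2 (c i)) ('D_e2 ('D_e2 (c i)) (t, s)).
Proof. by move=> tT s01; have [_ [_ h _ _]] := smooth i tT s01; exact: DeriveDef h erefl. Qed.

Let c1c i t s : t \in `[0, T] -> s \in `[0, 1] ->
  {for (t, s), continuous ('D_e1 (c i))}.
Proof. by move=> tT s01; have [[_ _ h _] _] := smooth i tT s01; exact: h. Qed.

Let c2c i t s : t \in `[0, T] -> s \in `[0, 1] ->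
  {for (t, s), continuous ('D_e2 (c i))}.
Proof. by move=> tT s01; have [[_ _ _ h] _] := smooth i tT s01; exact: h. Qed.

Let c12c i t s : t \in `[0, T] -> s \in `[0, 1] ->
  {for (t, s), continuous ('D_e1 ('D_e2 (c i)))}.
Proof. by move=> tT s01; have [_ [_ _ h _]] := smooth i tT s01; exact: h. Qed.

Let c22c i t s : t \in `[0, T] -> s \in `[0, 1] ->
  {for (t, s), continuous ('D_e2 ('D_e2 (c i)))}.
Proof. by move=> tT s01; have [_ [_ _ _ h]] := smooth i tT s01; exact: h. Qed.

Let c2_neq0 i t s : t \in `[0, T] -> s \in `[0, 1] -> 'D_e2 (c i) (t, s) <> 0.
Proof. by move=> tT s01; apply: (curve_immersed (solution_network hw tT)). Qed.

Let cinj i t : t \in `[0, T] -> {in `[0, 1] &, injective (fun s => c i (t, s))}.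
Proof. by move=> tT; exact: (curve_injective (solution_network hw tT)). Qed.

Let tau' i t s :=
  derive_unit (fun z => 'D_e2 (c i) (t, z)) ('D_e2 ('D_e2 (c i)) (t, s)) s.

Let slice_d2 i t s : t \in `[0, T] -> s \in `[0, 1] ->
  is_derive s 1 (fun z => c i (t, z)) ('D_e2 (c i) (t, s)).
Proof. by move=> tT s01; apply/slice2E; exact: cd2. Qed.

Let slice_c2 i t s : t \in `[0, T] -> s \in `[0, 1] ->
  {for s, continuous (fun z => 'D_e2 (c i) (t, z))}.
Proof.
by move=> tT s01; apply: (@slice2_continuous _ _ ('D_e2 (c i)) t s); exact: c2c.
Qed.

Let arc_lip t i : t \in `[0, T] -> exists2 L, 0 <= L &
  lipschitz_arc 0 1 L (fun s => curve N i (t, s)).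
Proof.
move=> tT; exact: (arc_speed_bound (fun s => @slice_d2 i t s tT)
  (fun s => @slice_c2 i t s tT)).
Qed.

Let tau'E i t s : t \in `[0, T] -> s \in `[0, 1] ->
  'D_e2 (tangent N i) (t, s) = tau' i t s.
Proof.
move=> tT s01.
have h := @tangent_derive R T ('D_e2 (c i)) ('D_e2 ('D_e2 (c i)))
  (cd22 i) (@c2_neq0 i) t s tT s01.
have [_ <-] : is_derive (t, s) e2 (tangent N i) (tau' i t s) by apply/slice2E.
by [].
Qed.

(** Only the component along the normal enters, but the curvature vector has no
other one. *)
Let weighted_curvature i t s : t \in `[0, T] -> s \in `]0, 1[ ->
  curvature N i t s * normal_velocity N i t s =
  dot ('D_e1 (c i) (t, s)) ((enorm ('D_e2 (c i) (t, s)))^-1 *: tau' i t s).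
Proof.
move=> tT s01; have s01' : s \in `[0, 1] by exact: subset_itv_oo_cc.
have hN := solution_network hw tT.
rewrite /curvature /normal_velocity mulrC /curvature_vector tau'E//.
have Gx : Gamma N i t (c i (t, s)) by exists s.
have ortho : dot ((enorm ('D_e2 (c i) (t, s)))^-1 *: tau' i t s)
    ('D_e2 (c i) (t, s)) = 0.
  rewrite dotZl (derive_unit_orthogonal (u := fun z => 'D_e2 (c i) (t, z))) ?mulr0//.
  exact: c2_neq0.
exact: (dot_orthogonal ('D_e1 (c i) (t, s)) (@c2_neq0 i t s tT s01')
  (normal_unit hN Gx) (normal_orthogonal hN i s01') ortho).
Qed.

(** The speed in the line integral cancels the factor that makes tau' a
derivative with respect to arclength. *)
Lemma dissipation_curvature t : t \in `[0, T] ->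
  \int[L2 R]_(x in Omega) (\sum_(k < 3) enorm (grad (w t k) x) ^+ 2) =
  \sum_(i < 3) sigma i *
    \int[lebesgue_measure]_(s in `[0, 1]) dot ('D_e1 (c i) (t, s)) (tau' i t s).
Proof.
move=> tT; have hN := solution_network hw tT.
have hL i := @arc_lip t i tT.
have hG j := @solution_gauss_green _ _ _ _ _ _ _ _ hw t j tT.
have hR := solution_regular hw tT; have hM := solution_equations hw tT.
rewrite (dissipation_interfaces hO hN hL hG hR hM); apply: eq_bigr => i _.
have kc s : s \in `[0, 1] -> {for s, continuous (fun s =>
    dot ('D_e1 (c i) (t, s)) (tau' i t s))}.
  move=> s01.
  have h1 : {for s, continuous (fun z => 'D_e1 (c i) (t, z))}.
    by apply: (@slice2_continuous _ _ ('D_e1 (c i)) t s); exact: c1c.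
  have h2 : {for s, continuous (tau' i t)}.
    exact: (@tangent_derive_continuous R T ('D_e2 (c i)) ('D_e2 ('D_e2 (c i)))
      (@c2c i) (@c22c i) (@c2_neq0 i) t s tT s01).
  exact: (cvg_dot h1 h2).
pose h s := sigma i * dot ('D_e1 (c i) (t, s))
  ((enorm ('D_e2 (c i) (t, s)))^-1 *: tau' i t s).
have hc s : s \in `[0, 1] -> {for s, continuous h}.
  move=> s01; apply: cvgM; first exact: cvg_cst.
  have -> : (fun s => dot ('D_e1 (c i) (t, s))
      ((enorm ('D_e2 (c i) (t, s)))^-1 *: tau' i t s)) =
      (fun s => (enorm ('D_e2 (c i) (t, s)))^-1 *
        dot ('D_e1 (c i) (t, s)) (tau' i t s)).
    by apply/funext => z; rewrite dotZr.
  have invc : (enorm ('D_e2 (c i) (t, z)))^-1 @[z --> s] -->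
      (enorm ('D_e2 (c i) (t, s)))^-1.
    exact: cvg_enormV (@c2_neq0 i t s tT s01) (@slice_c2 i t s tT s01).
  rewrite dotZr; exact: cvgM invc (kc s s01).
transitivity (\int[lebesgue_measure]_(s in `[0, 1]) (h s * enorm ('D_e2 (c i) (t, s)))).
  have fi := interface_flux_integrable hO hN hL hR i.
  have L := @line_integral R (fun s => c i (t, s)) (fun s => 'D_e2 (c i) (t, s))
    (fun s => @slice_d2 i t s tT) (fun s => @slice_c2 i t s tT) (@cinj i t tT) _ h fi hc.
  apply: L => s s01.
  by rewrite (interface_flux hN hR hM i s01) /h -weighted_curvature// mulrA.
rewrite -RintegralZl//; last exact: itv_integrable.
apply: eq_Rintegral => s; rewrite inE /= => s01.
rewrite /h dotZr; have := lt0r_neq0 (enorm_gt0 (@c2_neq0 i t s tT s01)).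
by move=> ?; field.
Qed.

(** The junction is a single moving point during [0, T], where derivatives, if
only one-sided at the ends, are unique. *)
Lemma junction_velocity i j t (e : R) : t \in `[0, T] -> e \in `[0, 1] ->
  (forall r, r \in `[0, T] -> c i (r, e) = c j (r, e)) ->
  'D_e1 (c i) (t, e) = 'D_e1 (c j) (t, e).
Proof.
move=> tT e01 cij.
have di := (slice1E _ _ _ _).1 (cd1 i tT e01).
have dj := (slice1E _ _ _ _).1 (cd1 j tT e01).
apply: injective_projections.
- have di' : is_derive_within `[0, T] (fun r => (c i (r, e)).1) t
    ('D_e1 (c i) (t, e)).1 := is_derive_is_derive_within _ (is_derive_fst di).
  have dj' : is_derive_within `[0, T] (fun r => (c j (r, e)).1) t
    ('D_e1 (c j) (t, e)).1 := is_derive_is_derive_within _ (is_derive_fst dj).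
  apply: (is_derive_within_unique T0 tT di').
  by apply: (eq_is_derive_within _ _ dj') => // r rT; rewrite cij.
- have di' : is_derive_within `[0, T] (fun r => (c i (r, e)).2) t
    ('D_e1 (c i) (t, e)).2 := is_derive_is_derive_within _ (is_derive_snd di).
  have dj' : is_derive_within `[0, T] (fun r => (c j (r, e)).2) t
    ('D_e1 (c j) (t, e)).2 := is_derive_is_derive_within _ (is_derive_snd dj).
  apply: (is_derive_within_unique T0 tT di').
  by apply: (eq_is_derive_within _ _ dj') => // r rT; rewrite cij.
Qed.

(** Young's law: the weighted boundary terms of the first variation are the
product of the common velocity of a junction with the sum of the weighted
conormals. *)
Lemma junction_balance t : t \in `[0, T] ->
  \sum_(i < 3) sigma i * (dot (tangent N i (t, 1)) ('D_e1 (c i) (t, 1)) -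
    dot (tangent N i (t, 0)) ('D_e1 (c i) (t, 0))) = 0.
Proof.
move=> tT; have hM := solution_equations hw tT.
have o01 : 0 \in `[0, 1 : R] by rewrite in_itv/= lexx ler01.
have i01 : 1 \in `[0, 1 : R] by rewrite in_itv/= lexx ler01.
have v1 i : 'D_e1 (c i) (t, 1) = 'D_e1 (c ord0) (t, 1).
  by apply: junction_velocity => // r rT; exact: (curve_stop (solution_network hw rT)).
have v0 i : 'D_e1 (c i) (t, 0) = 'D_e1 (c ord0) (t, 0).
  by apply: junction_velocity => // r rT; exact: (curve_start (solution_network hw rT)).
transitivity (dot (\sum_(i < 3) sigma i *: conormal N i t true) ('D_e1 (c ord0) (t, 1)) +
    dot (\sum_(i < 3) sigma i *: conormal N i t false) ('D_e1 (c ord0) (t, 0))).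
  rewrite !dot_suml -big_split/=; apply: eq_bigr => i _.
  by rewrite v1 v0 2!dotZl /conormal dotNl mulrN mulrBr.
have y1 := young_law hM true; have y0 := young_law hM false.
by rewrite y1 y0 !dot0l addr0.
Qed.

Lemma weighted_length_derive t : t \in `[0, T] ->
  is_derive_within `[0, T] (weighted_length sigma N) t
    (- \int[L2 R]_(x in Omega) (\sum_(k < 3) enorm (grad (w t k) x) ^+ 2)).
Proof.
move=> tT; rewrite dissipation_curvature//.
have fv i := @first_variation R T (c i) ('D_e1 (c i)) ('D_e2 (c i))
  ('D_e1 ('D_e2 (c i))) ('D_e2 ('D_e2 (c i))) T0 (cd1 i) (cd2 i) (cd12 i) (cd22 i) (@c1c i)
  (@c2c i) (@c12c i) (@c22c i) (@c2_neq0 i) (fun t => @cinj i t) t tT.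
have := @is_derive_within_sum R _ 3 sigma _ _ t fv.
under eq_bigr do rewrite mulrBr.
by rewrite sumrB junction_balance// sub0r.
Qed.

End energy.

Theorem proposition2p1 (R : realType) (Omega : set (R * R))
    (nuO : R * R -> R * R) (sigma : 'I_3 -> R) (T : R)
    (Gamma0 : set (R * R)) (N : network R) (w : R -> 'I_3 -> R * R -> R)
    (hOmega : is_bounded_domain Omega nuO)
    (hsigma : forall i, sigma i <= sigma (ordS i) + sigma (ord_pred i))
    (hT : 0 < T)
    (hw : is_strong_solution Omega nuO sigma T Gamma0 N w)
    (t : R) (ht : t \in `[0, T]) :
  exists l : R,
    is_derive_within `[0, T] (weighted_length sigma N) t l /\
    l + \int[L2 R]_(x in Omega) (\sum_(k < 3) enorm (grad (w t k) x) ^+ 2) = 0.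
Proof.
exists (- \int[L2 R]_(x in Omega) (\sum_(k < 3) enorm (grad (w t k) x) ^+ 2)).
split; last by rewrite addNr.
exact: weighted_length_derive hOmega hT hw t ht.
Qed.
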